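(* Let $d\geq1$ be an integer, $a>0$, $(\alpha,\beta,\gamma)\in\mathcal P_d$, and let $k$ be a positive integer. The function $r\mapsto g_d(r;a,\alpha,\beta,\gamma)$ from $\mathbb{R}_+$ to $\mathbb{R}$ is $k$ times differentiable at $r=0$ (therefore, it can be associated with a $\lfloor k/2\rfloor$ times mean-square differentiable random field) if, and only if, $\alpha>\frac{k+d}{2}$.
   Context: $\mathbb{R}_+=[0,+\infty[$. $\mathcal P_d$ is the set of triplets $(\alpha,\beta,\gamma)$ of positive reals with $\alpha>\frac d2$, $2(\beta-\alpha)(\gamma-\alpha)\geq\alpha$ and $2(\beta+\gamma)\geq6\alpha+1$ (these imply $\beta>\alpha$, $\gamma>\alpha$). The function $g_d$ is the radial part of the Gauss hypergeometric covariance kernel $\boldsymbol h\mapsto g_d(\|\boldsymbol h\|;a,\alpha,\beta,\gamma)$ in $\mathbb{R}^d$; for $r\geq0$, $$g_d(r;a,\alpha,\beta,\gamma)=\frac{\Gamma(\beta-\frac d2)\Gamma(\gamma-\frac d2)}{\Gamma(\beta-\alpha+\gamma-\frac d2)\Gamma(\alpha-\frac d2)}\left(1-\frac{r^2}{a^2}\right)_+^{\beta-\alpha+\gamma-\frac d2-1}{}_2F_1\left(\beta-\alpha,\gamma-\alpha;\beta-\alpha+\gamma-\tfrac d2;\left(1-\tfrac{r^2}{a^2}\right)_+\right),$$ where $(x)_+=\max\{x,0\}$ and ${}_2F_1$ is the Gauss hypergeometric function. The random field in question is a second-order stationary random field in $\mathbb{R}^d$ having this kernel as its covariance. $\lfloor\cdot\rfloor$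 is the floor function.
   Formalization: Differentiability at r=0 is taken two-sidedly for the even extension r ↦ g_d(|r|) on all of ℝ; with one-sided derivatives on ℝ_+ the ''only if'' fails, e.g. d=3, α=2, β=3, γ=4, k=1. *)

(* Defs.v *)
From HB Require Import structures.
From mathcomp Require Export all_boot all_order all_algebra.
From mathcomp Require Export all_classical all_reals all_analysis.

Set Implicit Arguments.
Unset Strict Implicit.
Unset Printing Implicit Defensive.

Import Order.TTheory GRing.Theory Num.Theory.
Import numFieldNormedType.Exports.

Local Open Scope classical_set_scope.
Local Open Scope ring_scope.

(* Euler's integral, equal to the Gamma function for 0 < x only; under
   [in_Pd d alpha beta gamma] all the arguments occurring below are positive. *)
Definition Gamma (R : realType) (x : R) : R :=
  \int[lebesgue_measure]_(t in `]0, +oo[) (t `^ (x - 1) * expR (- t)).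

Definition pochhammer (R : realType) (x : R) (n : nat) : R :=
  \prod_(i < n) (x + i%:R).

(* Sum of the Gauss series, for z in [0, 1]. At z = 1 it converges when
   p + q < s; in [gauss_cov] this reads d / 2 < alpha. *)
Definition hyp2F1 (R : realType) (p q s z : R) : R :=
  limn (series (fun n : nat =>
    pochhammer p n * pochhammer q n / (pochhammer s n * (n`!)%:R) * z ^+ n)).

Definition in_Pd (R : realType) (d : nat) (alpha beta gamma : R) : Prop :=
  [/\ [/\ 0 < alpha, 0 < beta & 0 < gamma],
      d%:R / 2 < alpha,
      alpha <= 2 * (beta - alpha) * (gamma - alpha) &
      6 * alpha + 1 <= 2 * (beta + gamma)].

(* Since r enters only through r ^+ 2, the formula is taken for all real r;
   on negative arguments it is the even extension of the radial function. *)
Definition gauss_cov (R : realType) (d : nat) (a alpha beta gamma r : R) : R :=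
  let h := d%:R / 2 in
  let u := Num.max (1 - r ^+ 2 / a ^+ 2) 0 in
  Gamma (beta - h) * Gamma (gamma - h)
    / (Gamma (beta - alpha + gamma - h) * Gamma (alpha - h))
    * u `^ (beta - alpha + gamma - h - 1)
    * hyp2F1 (beta - alpha) (gamma - alpha) (beta - alpha + gamma - h) u.

(* [derive1n] is total, hence the lower-order derivatives must be required to
   exist in a neighbourhood of x. *)
Fixpoint times_derivable (R : realType) (k : nat) (f : R -> R) (x : R) : Prop :=
  if k is k'.+1 then
    (\forall y \near x, times_derivable k' f y) /\ derivable (derive1n k' f) x 1
  else True.

(* The norm [`|x|] of the library on row vectors is the sup norm. *)
Definition euclidean_norm (R : realType) (d : nat) (x : 'rV[R]_d) : R :=
  Num.sqrt (\sum_(i < d) x ord0 i ^+ 2).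

Definition stationary_field_with_cov (R : realType) (d : nat)
    (disp : measure_display) (T : measurableType disp) (P : probability T R)
    (K : 'rV[R]_d -> R) (Z : 'rV[R]_d -> {RV P >-> R}) : Prop :=
  [/\ forall x, (Z x : T -> R) \in Lfun P 2%:E,
      exists m : R, forall x, 'E_P[Z x]%E = m%:E &
      forall x y, covariance P (Z x) (Z y) = (K (x - y))%:E].

(* Y is the mean-square derivative of Z in the direction v. *)
Definition ms_derivative (R : realType) (d : nat)
    (disp : measure_display) (T : measurableType disp) (P : probability T R)
    (Z : 'rV[R]_d -> {RV P >-> R}) (v : 'rV[R]_d)
    (Y : 'rV[R]_d -> {RV P >-> R}) : Prop :=
  forall x : 'rV[R]_d,
    (fun h : R =>
       'E_P[(fun w : T => ((Z (x + h *: v) w - Z x w) / h - Y x w) ^+ 2)%R]%E)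
      @ 0^' --> 0%E.

(* Iterated mean-square derivatives, in all successive directions. *)
Fixpoint ms_differentiable (R : realType) (d : nat)
    (disp : measure_display) (T : measurableType disp) (P : probability T R)
    (m : nat) (Z : 'rV[R]_d -> {RV P >-> R}) : Prop :=
  if m is m'.+1 then
    forall v : 'rV[R]_d, exists Y : 'rV[R]_d -> {RV P >-> R},
      ms_derivative Z v Y /\ ms_differentiable m' Y
  else True.

(* Main.v *)
(* Put nu = alpha - d/2.  In the variable x = r^2/a^2, the N-th derivative of the radial
   function is, up to sign, a power of 1 - x times a power series in 1 - x, whose
   coefficients, when N > nu, are eventually positive and comparable with those of
   (1 - u)^(nu - N); so it is of exact order x^(nu - N) as x -> 0.

   If k < 2 nu, pick e with k < 2e < k + 1 and e < nu.  Integrating down from a large N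
   gives a polynomial in x plus a remainder whose i-th derivative is O(x^(e - i)).
   Substituting x = |h|^2/a^2 gives a function of h in R^d that can be differentiated k
   times along lines near the origin, which yields the radial derivatives.  It also makes
   the Gram matrix of the difference quotients of the field converge, so these have L^2
   limits, whose covariance is minus the second derivative of the original one; iterate.

   Conversely, if the function is k times differentiable at 0, Taylor's formula with
   Peano remainder and evenness give a polynomial in x up to o(x^(k/2)).  If k >= 2 nu,
   the N-th finite difference with step x of the error is o(x^nu), whereas the mean value
   theorem bounds it below by a multiple of x^N x^(nu - N) = x^nu. *)
Require Import Defs.
From mathcomp Require Import measurable_realfun ring lra zify.

Set Implicit Arguments.
Unset Strict Implicit.
Unset Printing Implicit Defensive.

Import Order.TTheory GRing.Theory Num.Theory.
Import numFieldNormedType.Exports.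

Local Open Scope classical_set_scope.
Local Open Scope ring_scope.

(** * Derivatives and differences of real functions *)

(** The connection formula of 2F1 at 1 degenerates, with logarithms, when nu is an integer. Only
    orders of magnitude matter here, and a comparison of coefficients gives them for every nu alike;
    replacing nu by e in the regular part is harmless because k < 2 nu is strict. In the converse
    direction, k derivatives at 0 say nothing about the higher derivatives of the error, hence the
    recourse to finite differences, which use its values only. A derivative along a line of a radial
    function is no longer radial. The class of sums of P(h) phi_i(|h|^2/a^2), with P a polynomial,
    is stable under such derivatives and serves both the radial function and the second moments of
    the successive fields. At r = 0 the Gauss series is summed at 1, the end of its interval of
    convergence, so the expansion has to be extended to that point separately. *)

Section is_derive_pointwise.
Context {R : realType}.
Implicit Types (f g : R -> R) (x a b c : R).

Lemma is_derive_add f g x a b : is_derive x 1 f a -> is_derive x 1 g b ->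
  is_derive x 1 (fun t => f t + g t) (a + b).
Proof. exact: is_deriveD. Qed.

Lemma is_derive_sub f g x a b : is_derive x 1 f a -> is_derive x 1 g b ->
  is_derive x 1 (fun t => f t - g t) (a - b).
Proof. exact: is_deriveB. Qed.

Lemma is_derive_mul f g x a b : is_derive x 1 f a -> is_derive x 1 g b ->
  is_derive x 1 (fun t => f t * g t) (f x * b + g x * a).
Proof. exact: is_deriveM. Qed.

Lemma is_derive_scale f x a c : is_derive x 1 f a ->
  is_derive x 1 (fun t => c * f t) (c * a).
Proof.
by move=> fa; have := is_deriveM (is_derive_cst c x 1) fa; rewrite scaler0 addr0.
Qed.

Lemma is_derive_comp f g x a b : is_derive (g x) 1 f a -> is_derive x 1 g b ->
  is_derive x 1 (fun t => f (g t)) (a * b).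
Proof. exact: is_derive1_comp. Qed.

Lemma is_derive_addr (x c : R) : is_derive x 1 (fun t => t + c) 1.
Proof. by have := is_derive_add (is_derive_id x 1) (is_derive_cst c x 1); rewrite addr0. Qed.

Lemma is_derive_subl (c x : R) : is_derive x 1 (fun t => c - t) (-1).
Proof.
have H1 : is_derive x 1 (fun=> c : R) 0 by exact: is_derive_cst.
by have := is_derive_sub H1 (is_derive_id x 1); rewrite sub0r.
Qed.

End is_derive_pointwise.

Lemma one_powR (R : realType) (e : R) : 1 `^ e = 1.
Proof. by rewrite powR1. Qed.

Lemma le0_ger_powR (R : realType) (e x y : R) :
  e <= 0 -> 0 < x -> x <= y -> y `^ e <= x `^ e.
Proof.
move=> e0 x0 xy; have y0 := lt_le_trans x0 xy.
have E z : z `^ e = (z `^ (- e))^-1 by rewrite powRN invrK.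
rewrite !E lef_pV2 ?posrE ?powR_gt0// ge0_ler_powR ?nnegrE ?oppr_ge0//; exact: ltW.
Qed.

Lemma mean_value (R : realType) (f df : R -> R) (a b : R) :
  a <= b -> (forall x : R, a <= x <= b -> is_derive x 1 f (df x)) ->
  exists2 c, a <= c <= b & f b - f a = df c * (b - a).
Proof.
move=> ab fd; have [||c cab ->] := @MVT_segment R f df a b ab.
- by move=> x; rewrite in_itv/= => /andP[/ltW ax /ltW xb]; apply: fd; rewrite ax.
- apply: derivable_within_continuous => x; rewrite in_itv/= => xab.
  by have [] := fd x xab.
by exists c => //; move: cab; rewrite in_itv.
Qed.

Lemma mean_value_ball (R : realType) (f df : R -> R) (d a b : R) :
  `|a| <= d -> `|b| <= d -> (forall x : R, `|x| <= d -> is_derive x 1 f (df x)) ->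
  exists2 c, `|c| <= d & f b - f a = df c * (b - a).
Proof.
rewrite !ler_norml => /andP[ad da] /andP[bd db] fd.
have [ab|/ltW ba] := leP a b.
  have [x /andP[ax xb]|c /andP[ac cb] ->] := @mean_value _ f df _ _ ab.
    by apply: fd; rewrite ler_norml; lra.
  by exists c => //; rewrite ler_norml; lra.
have [x /andP[ax xb]|c /andP[ac cb] E] := @mean_value _ f df _ _ ba.
  by apply: fd; rewrite ler_norml; lra.
exists c; first by rewrite ler_norml; lra.
by rewrite -opprB E; ring.
Qed.

Lemma monotone_ge0_derive (R : realType) (f df : R -> R) (a b : R) :
  a <= b -> (forall x : R, a <= x <= b -> is_derive x 1 f (df x)) ->
  (forall x : R, a <= x <= b -> 0 <= df x) -> f a <= f b.
Proof.
move=> ab fd dfge0; have [c cab E] := mean_value ab fd.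
by rewrite -subr_ge0 E mulr_ge0 ?dfge0 // subr_ge0.
Qed.

Definition derivative_chain (R : realType) (x0 : R) (psi : nat -> R -> R) :=
  forall i x, 0 < x < x0 -> is_derive x 1 (psi i) (psi i.+1 x).

(** Both C / e * x ^ e + f and C / e * x ^ e - f are nondecreasing, their derivatives being C * x ^
    (e - 1) plus or minus [df]. When e is negative, so is C / e, and the bound keeps its sense. *)
Lemma primitive_bound (R : realType) (f df : R -> R) (C e x0 : R) :
  e != 0 -> (forall x : R, 0 < x < x0 -> is_derive x 1 f (df x)) ->
  (forall x : R, 0 < x < x0 -> `|df x| <= C * x `^ (e - 1)) ->
  forall x y : R, 0 < x -> x <= y -> y < x0 ->
    `|f y - f x| <= C / e * (y `^ e - x `^ e).
Proof.
move=> e0 fd dfle x y x_gt0 xy yx0.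
have in0 z : x <= z <= y -> 0 < z < x0 by move=> /andP[? ?]; apply/andP; split; lra.
(* [s] is 1 or -1: one monotonicity argument gives both halves of the absolute value. *)
have key (s : R) : s ^+ 2 = 1 -> s * (f y - f x) <= C / e * (y `^ e - x `^ e).
  move=> s1; rewrite -subr_ge0.
  suff : C / e * x `^ e - s * f x <= C / e * y `^ e - s * f y by lra.
  apply: (@monotone_ge0_derive _ (fun z => C / e * z `^ e - s * f z)
    (fun z => C * z `^ (e - 1) - s * df z)) => // z zxy.
    have z0 : 0 < z by case/andP: (in0 z zxy).
    have H1 := is_derive_scale s (fd z (in0 z zxy)).
    have H2 := is_derive_scale (C / e) (is_derive1_powR e z0).
    apply: trigger_derive (is_derive_sub H2 H1) _.
    by congr (_ - _); rewrite mulrA divfK.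
  rewrite subr_ge0 (le_trans _ (dfle z (in0 z zxy)))//.
  have : s == 1 \/ s == -1 by move/eqP: s1; rewrite sqrf_eq1 => /orP.
  by move=> [|] /eqP ->; rewrite ?mul1r ?mulN1r ?ler_norm// -normrN ler_norm.
rewrite ler_norml; apply/andP; split.
  by have := key (-1); rewrite sqrrN expr1n mulN1r => /(_ erefl); lra.
by have := key 1; rewrite expr1n mul1r => /(_ erefl).
Qed.

(** Stands in for the limit of a function at 0+: a number between all lower and all upper estimates
    is a constant of integration that comes with its error bound. *)
Lemma sup_between (R : realType) (A B : R -> R) (x0 : R) : 0 < x0 ->
  (forall x y, 0 < x < x0 -> 0 < y < x0 -> A x <= B y) ->
  exists c, forall x, 0 < x < x0 -> A x <= c <= B x.
Proof.
move=> x0_gt0 AB.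
have h : 0 < x0 / 2 < x0 by apply/andP; split; lra.
pose S := [set A x | x in [set x | 0 < x < x0]].
have ubB y : 0 < y < x0 -> ubound S (B y).
  by move=> yI _ [x xI <-]; exact: AB.
have supS : has_sup S.
  by split; [exists (A (x0 / 2)), (x0 / 2) | exists (B (x0 / 2)); exact: ubB].
exists (sup S) => x xI; apply/andP; split.
  by apply: ub_le_sup; [case: supS | exists x].
by apply: ge_sup; [case: supS | exact: ubB].
Qed.

Lemma integrate_once (R : realType) (f df : R -> R) (C e x0 : R) :
  0 < x0 -> e != 0 -> (forall x : R, 0 < x < x0 -> is_derive x 1 f (df x)) ->
  (forall x : R, 0 < x < x0 -> `|df x| <= C * x `^ (e - 1)) ->
  exists c x1 C', [/\ 0 < x1 <= x0 &
    forall x, 0 < x < x1 -> `|f x - c| <= C' * x `^ e].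
Proof.
move=> x0_gt0 e0 fd dfle.
have pb := primitive_bound e0 fd dfle.
have C0 : 0 <= C.
  have hx : 0 < x0 / 2 < x0 by apply/andP; split; lra.
  have := le_trans (normr_ge0 _) (dfle _ hx).
  by rewrite pmulr_lge0// powR_gt0//; lra.
have [e_lt0|e_gt0|/eqP] := ltgtP e 0; last by rewrite (negbTE e0).
  pose y := x0 / 2; have y0 : 0 < y < x0 by rewrite /y; apply/andP; split; lra.
  have [y_gt0 yx0] := andP y0.
  (* For e < 0, x ^ e >= y ^ e, so the value of [f] at the fixed end point is absorbed by |f y| / y
     ^ e * x ^ e, and the constant of integration can be 0. *)
  exists 0, y, (`|f y| / y `^ e + C / - e); split; first by rewrite y_gt0 ltW.
  move=> x /andP[x_gt0 xy]; rewrite subr0.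
  have {}pb := pb x y x_gt0 (ltW xy) yx0.
  have : `|f x| <= `|f y| + `|f y - f x|.
    by rewrite -{1}(subKr (f y) (f x)) (le_trans (ler_normB _ _)).
  move/le_trans; apply; rewrite mulrDl lerD//.
    rewrite -mulrA ler_peMr// mulrC ler_pdivlMr ?powR_gt0// mul1r.
    by rewrite le0_ger_powR// ltW.
  apply: le_trans pb _.
  rewrite invrN mulrN mulNr -mulrN ler_wnM2l//.
    by rewrite mulr_ge0_le0// invr_le0 ltW.
  by rewrite lerBrDr addNr powR_ge0.
have De : 0 <= C / e by rewrite divr_ge0// ltW.
have [|c cP] := @sup_between R (fun x => f x - C / e * x `^ e)
  (fun x => f x + C / e * x `^ e) x0 x0_gt0.
  move=> x y /andP[x_gt0 xx0] /andP[y_gt0 yx0].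
  have px : 0 <= C / e * x `^ e by rewrite mulr_ge0 ?powR_ge0.
  have py : 0 <= C / e * y `^ e by rewrite mulr_ge0 ?powR_ge0.
  have [xy|/ltW yx] := leP x y.
    have := pb x y x_gt0 xy yx0; rewrite ler_norml mulrBr => /andP[H1 H2]; lra.
  have := pb y x y_gt0 yx xx0; rewrite ler_norml mulrBr => /andP[H1 H2]; lra.
exists c, x0, (C / e); split; first by rewrite x0_gt0/=.
by move=> x /cP /andP[H1 H2]; rewrite ler_norml; apply/andP; split; lra.
Qed.

Lemma poly_antiderivative (R : numFieldType) (Q : {poly R}) (c : R) :
  exists P : {poly R}, P^`() = Q /\ P.[0] = c.
Proof.
exists (\poly_(i < (size Q).+1) (if i is j.+1 then Q`_j / j.+1%:R else c)).
split; last by rewrite horner_coef0 coef_poly.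
apply/polyP => i; rewrite coef_deriv coef_poly ltnS.
case: ltnP => [_|/leq_sizeP/(_ i (leqnn _)) ->]; last by rewrite mul0rn.
by rewrite -[LHS]mulr_natr/= divfK// pnatr_eq0.
Qed.

(* Were [e] a natural number, integrating [x ^ -1] would produce a logarithm. *)
Lemma integrate_down (R : realType) (N : nat) (psi : nat -> R -> R) (C e x0 : R) :
  0 < x0 -> (forall n : nat, e != n%:R) -> derivative_chain x0 psi ->
  (forall x : R, 0 < x < x0 -> `|psi N x| <= C * x `^ (e - N%:R)) ->
  exists (Q : {poly R}) x1 C', 0 < x1 <= x0 /\
    forall i x, (i <= N)%N -> 0 < x < x1 ->
      `|psi i x - (Q^`(i)).[x]| <= C' * x `^ (e - i%:R).
Proof.
elim: N psi e => [|N IH] psi e x0_gt0 eN ch psiN.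
  exists 0, x0, C; split; first by rewrite x0_gt0/=.
  by move=> i x; rewrite leqn0 => /eqP -> xI; rewrite derivn0 horner0 subr0; exact: psiN.
have [|||Q1 [x1 [C1 [/andP[x1_gt0 x1x0] H1]]]] :=
    IH (fun i => psi i.+1) (e - 1) x0_gt0.
- by move=> n; rewrite subr_eq natr1; exact: eN.
- by move=> i x; exact: ch.
- by move=> x xI; rewrite -addrA -opprD -(natrD _ 1 N); exact: psiN.
have [Q2 [Q2' _]] := poly_antiderivative Q1 0.
have in01 x : 0 < x < x1 -> 0 < x < x0.
  by move=> /andP[-> /lt_le_trans]; exact.
have [|x /in01 xI|x xI|c [x2 [C2 [/andP[x2_gt0 x2x1] H2]]]] :=
  @integrate_once R (fun x => psi 0 x - Q2.[x]) (fun x => psi 1 x - Q1.[x])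
    C1 e x1 x1_gt0.
- exact: (eN 0).
- by have H := ch 0 x xI; rewrite -Q2'; apply: is_derive_sub.
- by have := H1 0 x (leq0n _) xI; rewrite subr0.
exists (Q2 + c%:P), x2, (Num.max C1 C2); split.
  by rewrite x2_gt0 (le_trans x2x1).
move=> [|i] x iN xI.
  rewrite derivn0 hornerD hornerC subr0 opprD addrA (le_trans (H2 x xI))//.
  by rewrite ler_wpM2r ?powR_ge0// le_max lexx orbT.
rewrite derivSn derivD derivC addr0 Q2'.
have := H1 i x iN; rewrite -addrA -opprD -(natrD _ 1 i).
move=> /(_ _)/le_trans; apply.
  by case/andP: xI => -> /lt_le_trans; exact.
by rewrite ler_wpM2r ?powR_ge0// le_max lexx.
Qed.

Definition fdiff (R : realType) (y : R) (f : R -> R) (x : R) : R := f (x + y) - f x.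

Lemma fdiff_ge (R : realType) (N : nat) (psi : nat -> R -> R) (x y m x0 : R) :
  derivative_chain x0 psi -> 0 < x -> 0 < y -> x + N%:R * y < x0 ->
  (forall z, x <= z <= x + N%:R * y -> m <= psi N z) ->
  m * y ^+ N <= iter N (fdiff y) (psi 0) x.
Proof.
move=> + x_gt0 y_gt0.
elim: N psi m x0 => [|N IH] psi m x0 ch xN psiN.
  by rewrite mulr1 psiN// mul0r addr0 lexx.
have NE : N.+1%:R * y = N%:R * y + y by rewrite -natr1 mulrDl mul1r.
rewrite iterSr exprS mulrA.
(* The differences of a chain form a chain on the interval shortened by y, and by the mean value
   theorem its N-th term is at least m * y. *)
apply: (IH (fun i => fdiff y (psi i)) (m * y) (x0 - y)).
- move=> i z /andP[z0 zx]; rewrite /fdiff.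
  have zy : 0 < z + y < x0 by apply/andP; split; lra.
  have zI : 0 < z < x0 by apply/andP; split; lra.
  have H1 := ch i _ zy; have H2 := ch i _ zI.
  have H3 : is_derive z 1 (fun t => psi i (t + y)) (psi i.+1 (z + y)).
    by have := @is_derive_comp _ (psi i) (+%R^~ y) z _ _ H1 (is_derive_addr z y); rewrite mulr1.
  exact: is_derive_sub.
- lra.
move=> z /andP[xz zx].
have zzy : z <= z + y by lra.
rewrite /fdiff; have [|c /andP[zc cz] ->] := @mean_value _ (psi N) (psi N.+1) _ _ zzy.
  by move=> t /andP[? ?]; apply: ch; apply/andP; split; lra.
by rewrite addrAC subrr add0r ler_pM2r// psiN//; apply/andP; split; lra.
Qed.

Lemma fdiff_le (R : realType) (N : nat) (f : R -> R) (x y m : R) :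
  0 <= y -> (forall z, x <= z <= x + N%:R * y -> `|f z| <= m) ->
  `|iter N (fdiff y) f x| <= 2 ^+ N * m.
Proof.
move=> y0; elim: N f m => [|N IH] f m fm.
  by rewrite mul1r fm// mul0r addr0 lexx.
have NE : N.+1%:R * y = N%:R * y + y by rewrite -natr1 mulrDl mul1r.
rewrite iterSr exprSr -mulrA; apply: IH => z /andP[xz zx].
rewrite /fdiff (le_trans (ler_normB _ _))// mulr_natl mulr2n lerD//.
  by apply: fm; apply/andP; split; lra.
by apply: fm; apply/andP; split; lra.
Qed.

(** * Iterated derivability and Taylor's formula with Peano remainder *)

Lemma near_norm_lt (R : realType) (x d : R) : `|x| < d -> \forall y \near x, `|y| < d.
Proof.
have H : y @[y --> x] --> x by exact: cvg_id.
by move=> xd; exact: (cvgr_norm_lt _ H _ xd).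
Qed.

Lemma times_derivable_derivable (R : realType) (k : nat) (f : R -> R) (x : R) :
  times_derivable k.+1 f x -> derivable f x 1.
Proof. by elim: k => [[]//|k IH] [/nbhs_singleton/IH]. Qed.

Lemma times_derivableW (R : realType) (k : nat) (f : R -> R) (x : R) :
  times_derivable k.+1 f x -> times_derivable k f x.
Proof. by case=> /nbhs_singleton. Qed.

(** [times_derivable] peels off the last derivative, whereas an induction over functions has to peel
    off the first. *)
Lemma times_derivable_derive1 (R : realType) (k : nat) (f : R -> R) (x : R) :
  times_derivable k.+1 f x -> times_derivable k (derive1 f) x.
Proof.
elim: k x => [//|k IH] x [fk dfk]; split; last by move: dfk; rewrite derive1Sn.
by near=> y; apply: IH; near: y.
Unshelve. all: by end_near. Qed.

Lemma times_derivableS_ball (R : realType) (k : nat) (f : R -> R) (d : R) :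
  (forall x : R, `|x| < d -> derivable f x 1 /\ times_derivable k (derive1 f) x) ->
  forall x : R, `|x| < d -> times_derivable k.+1 f x.
Proof.
elim: k => [|k IH] H x xd.
  by split; [near=> y | case: (H x xd)].
split.
  have yd : \forall y \near x, `|y| < d by exact: near_norm_lt.
  near=> y; apply: IH; last by near: y.
  by move=> z /H[? /times_derivableW].
by rewrite derive1Sn; case: (H x xd) => _ [].
Unshelve. all: by end_near. Qed.

(** The approximation [Q] of the derivative is integrated from the value f 0: by the mean value
    theorem, a bound e * |y| ^ (k + 1) on the derivative of the error becomes e * |r| ^ (k + 2). *)
Lemma poly_approx_of_times_derivable (R : realType) (k : nat) (f : R -> R) :
  times_derivable k.+1 f 0 -> exists T : {poly R}, forall e, 0 < e ->
    \forall r \near 0, `|f r - T.[r]| <= e * `|r| ^+ k.+1.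
Proof.
elim: k f => [|k IH] f fk.
  exists ((f 0)%:P + ((derive1 f) 0) *: 'X) => e e0.
  have fd := times_derivable_derivable fk.
  have : h^-1 *: (f (h *: 1 + 0) - f 0) @[h --> 0^'] --> (derive1 f) 0.
    by rewrite derive1E; exact: fd.
  move=> /cvgrPdist_le /(_ e e0); rewrite near_withinE; apply: filterS => h H.
  rewrite hornerD hornerC hornerZ hornerX.
  have [->|h0] := eqVneq h 0; first by rewrite mulr0 addr0 subrr normr0 mulr0.
  rewrite expr1 -ler_pdivrMr ?normr_gt0// -normf_div.
  apply: le_trans (H h0); rewrite distrC /GRing.scale/= mulr1 addr0.
  by rewrite le_eqVlt; apply/orP; left; apply/eqP; congr `|_|; field.
have [Q HQ] := IH _ (times_derivable_derive1 fk).
have [T [TQ T0]] := poly_antiderivative Q (f 0).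
exists T => e e0.
have fd : \forall y \near 0, derivable f y 1.
  case: fk => fk _; near=> y; apply: (@times_derivable_derivable _ k); near: y; exact: fk.
have /nbhs_ballP[d /= d0 Hd] : \forall y \near 0,
    derivable f y 1 /\ `|(derive1 f) y - Q.[y]| <= e * `|y| ^+ k.+1.
  by near=> y; split; near: y; [exact: fd | exact: HQ].
have nd : \forall r \near (0 : R), `|r| < d by apply: near_norm_lt; rewrite normr0.
near=> r.
have rd : `|r| < d by near: r; exact: nd.
have Hr (y : R) : `|y| <= `|r| -> ball 0 d y.
  by move=> yr; rewrite -ball_normE /= sub0r normrN (le_lt_trans yr).
have n0 : `|0 : R| <= `|r| by rewrite normr0.
have [y yr|c cr] := @mean_value_ball _ (fun y => f y - T.[y])
  (fun y => (derive1 f) y - Q.[y]) _ _ _ n0 (lexx _).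
  have [fy _] := Hd _ (Hr y yr); rewrite -TQ.
  apply: is_derive_sub; first by rewrite derive1E; exact/derivableP.
  exact: is_derive_poly.
rewrite T0 subrr !subr0 => ->; rewrite normrM exprSr mulrA ler_wpM2r//.
have [_ H] := Hd _ (Hr c cr); apply: le_trans H _.
by rewrite ler_wpM2l ?(ltW e0)// lerXn2r ?nnegrE.
Unshelve. all: by end_near. Qed.
(** * Power series on the unit interval *)

Section power_series.
Context {R : realType}.
Implicit Types (b : nat -> R) (z e : R).

(* The power series with coefficients [b] converges on [0, 1). *)
Definition subunit b := forall z, 0 <= z < 1 -> exists M, forall n, `|b n| * z ^+ n <= M.

Definition psum b z := limn (pseries b z).

Lemma powR_subr1 (e z : R) : 0 < z -> z `^ e = z `^ (e - 1) * z.
Proof.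
move=> z0; rewrite -[X in _ * X]powRr1 ?(ltW z0)// -powRD ?subrK//.
by rewrite (gt_eqF z0) implybT.
Qed.

Lemma eventually_nonincreasing_ub (x : nat -> R) (n0 : nat) :
  (forall n, (n0 <= n)%N -> x n.+1 <= x n) -> exists M, forall n, x n <= M.
Proof.
elim: n0 x => [|n0 IH] x xn.
  by exists (x 0) => n; elim: n => // n; apply: le_trans; exact: xn.
have [n nn|M HM] := IH (fun n => x n.+1); first exact: xn.
exists (Num.max (x 0) M) => -[|n]; first by rewrite le_max lexx.
by rewrite le_max HM orbT.
Qed.

Lemma natr_ge_ex (x : R) : exists n0 : nat, forall n, (n0 <= n)%N -> x <= n%:R.
Proof.
exists (Num.bound x) => n nx; have [x0|/ltW x0] := leP 0 x.
  by rewrite (le_trans (ltW (archi_boundP x0)))// ler_nat.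
by rewrite (le_trans x0).
Qed.

Lemma subunit_ratio b (C : R) (n0 : nat) :
  (forall n, (n0 <= n)%N -> (0 < n)%N -> `|b n.+1| * n%:R <= (n%:R + C) * `|b n|) ->
  subunit b.
Proof.
move=> bn z /andP[z0 z1].
(* This is the threshold beyond which (n + C) * z <= n, so that the terms no longer increase. *)
have [n1 Hn1] := natr_ge_ex (C * z / (1 - z)).
apply: (@eventually_nonincreasing_ub _ (maxn 1 (maxn n0 n1))) => n.
rewrite !geq_max => /and3P[n_gt0 nn0 nn1].
have := Hn1 n nn1; rewrite ler_pdivrMr ?subr_gt0// => H1.
have np : 0 < n%:R :> R by rewrite ltr0n.
rewrite -(ler_pM2l np) exprS.
have -> : n%:R * (`|b n.+1| * (z * z ^+ n)) = (`|b n.+1| * n%:R) * (z * z ^+ n) by ring.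
have zn : 0 <= z * z ^+ n by rewrite mulr_ge0 ?exprn_ge0.
apply: le_trans (ler_wpM2r zn (bn n nn0 n_gt0)) _.
have -> : (n%:R + C) * `|b n| * (z * z ^+ n) = ((n%:R + C) * z) * (`|b n| * z ^+ n) by ring.
rewrite ler_wpM2r//; first by rewrite mulr_ge0 ?exprn_ge0.
lra.
Qed.

(** The factor is absorbed by passing to the radius w halfway between z and 1, since (n + |e|) * (z
    / w) ^ n is bounded. *)
Lemma subunit_mulDn b e : subunit b -> subunit (fun n => (n%:R + e) * b n).
Proof.
move=> sb z /andP[z0 z1]; pose w := (1 + z) / 2.
have [M HM] : exists M, forall n, `|b n| * w ^+ n <= M.
  by apply: sb; rewrite /w; apply/andP; split; lra.
have w0 : 0 < w by rewrite /w; lra.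
have r0 : 0 <= z / w by rewrite divr_ge0// ltW.
have r1 : z / w < 1 by rewrite ltr_pdivrMr// /w; lra.
pose r := z / w.
have [n0 Hn0] := natr_ge_ex (r / (1 - r)).
have [|K HK] := @eventually_nonincreasing_ub (fun n => (n%:R + `|e|) * r ^+ n) n0.
  move=> n /Hn0; rewrite ler_pdivrMr ?subr_gt0// => H.
  rewrite exprS mulrA ler_wpM2r ?exprn_ge0// -natr1.
  have : 0 <= `|e| * (1 - r) by rewrite mulr_ge0// subr_ge0 ltW.
  rewrite /r in H *; lra.
exists (K * M) => n.
have -> : `|(n%:R + e) * b n| * z ^+ n = (`|n%:R + e| * r ^+ n) * (`|b n| * w ^+ n).
  by rewrite normrM /r expr_div_n; field; rewrite expf_eq0 gt_eqF// andbF.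
rewrite ler_pM ?mulr_ge0 ?exprn_ge0//; first exact: ltW.
apply: le_trans (HK n); rewrite ler_wpM2r ?exprn_ge0//.
by rewrite (le_trans (ler_normD _ _))// normr_nat.
Qed.

Lemma subunit_shift b : subunit b -> subunit (fun n => b n.+1).
Proof.
move=> sb z /andP[z0 z1]; pose w := (1 + z) / 2.
have [M HM] : exists M, forall n, `|b n| * w ^+ n <= M.
  by apply: sb; rewrite /w; apply/andP; split; lra.
have w0 : 0 < w by rewrite /w; lra.
exists (M / w) => n; rewrite ler_pdivlMr// (le_trans _ (HM n.+1))//.
rewrite exprSr [leRHS]mulrA ler_wpM2r ?(ltW w0)// ler_wpM2l// lerXn2r ?nnegrE//.
  exact: ltW.
by rewrite /w; lra.
Qed.

Lemma subunit_diffs b : subunit b -> subunit (pseries_diffs b).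
Proof.
move=> sb; have := subunit_shift (subunit_mulDn 0 sb).
by congr subunit; apply/funext => n; rewrite addr0.
Qed.

Lemma subunit_cvg b z : subunit b -> 0 <= z < 1 -> cvgn (pseries b z).
Proof.
move=> sb /andP[z0 z1]; pose w := (1 + z) / 2.
have [M HM] : exists M, forall n, `|b n| * w ^+ n <= M.
  by apply: sb; rewrite /w; apply/andP; split; lra.
have w0 : 0 < w by rewrite /w; lra.
have r0 : 0 <= z / w by rewrite divr_ge0// ltW.
have r1 : z / w < 1 by rewrite ltr_pdivrMr// /w; lra.
have M0 : 0 <= M by apply: le_trans (HM 0); rewrite mulr_ge0.
apply: normed_cvg.
apply: (@series_le_cvg _ _ (geometric M (z / w))) => [n|n|n|].
- exact: normr_ge0.
- by rewrite /geometric/= mulr_ge0 ?exprn_ge0.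
- rewrite /geometric/= normrM [`|z ^+ n|]ger0_norm ?exprn_ge0//.
  rewrite expr_div_n mulrA ler_pdivlMr ?exprn_gt0//.
  by rewrite mulrAC ler_wpM2r ?exprn_ge0.
- by apply: is_cvg_geometric_series; rewrite ger0_norm.
Qed.

Lemma is_derive_psum b z : subunit b -> 0 <= z < 1 ->
  is_derive z 1 (psum b) (psum (pseries_diffs b) z).
Proof.
move=> sb /andP[z0 z1]; pose w := (1 + z) / 2.
have w1 : 0 <= w < 1 by rewrite /w; apply/andP; split; lra.
apply: (@pseries_snd_diffs _ b w).
- exact: subunit_cvg.
- exact/subunit_cvg/w1/subunit_diffs.
- exact/subunit_cvg/w1/subunit_diffs/subunit_diffs.
- by rewrite !ger0_norm ?(andP w1).1// /w; lra.
Qed.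

(** Multiplying the coefficients by n + e amounts to applying the operator z d/dz + e. *)
Lemma psum_mulDn b e z : subunit b -> 0 <= z < 1 ->
  psum (fun n => (n%:R + e) * b n) z = z * psum (pseries_diffs b) z + e * psum b z.
Proof.
move=> sb zI.
have c1 := subunit_cvg (subunit_diffs sb) zI.
have c2 := subunit_cvg sb zI.
have E : limn [series i%:R * b i * z ^+ i.-1]_i = psum (pseries_diffs b) z.
  by apply: cvg_lim => //; exact: pseries_diffs_equiv.
have c3 := is_cvg_pseries_diffs_equiv c1.
have Ez : z * psum (pseries_diffs b) z =
    limn (series (z *: (fun i => i%:R * b i * z ^+ i.-1 : R^o))).
  by rewrite -E; apply/esym; exact: lim_seriesZ.
have Ee : e * psum b z = limn (series (e *: (fun i => b i * z ^+ i : R^o))).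
  by apply/esym; exact: lim_seriesZ.
rewrite Ez Ee -lim_seriesD; [|exact: is_cvg_seriesZ..].
congr (limn (series _)); apply/funext => n.
transitivity (z * (n%:R * b n * z ^+ n.-1) + e * (b n * z ^+ n)); last by [].
by case: n => [|n] /=; rewrite ?exprS; ring.
Qed.

(** The terms are b n * u ^ (n + e); the derivative has the same shape, with e - 1 and (n + e) * b
    n, so the step can be iterated. *)
Lemma is_derive_powR_psum b e z : subunit b -> 0 < z < 1 ->
  is_derive z 1 (fun u => u `^ e * psum b u)
    (z `^ (e - 1) * psum (fun n => (n%:R + e) * b n) z).
Proof.
move=> sb /andP[z0 z1]; have zI : 0 <= z < 1 by rewrite (ltW z0).
have H1 := is_derive_psum sb zI.
have H2 := is_derive1_powR e z0.
apply: trigger_derive (is_derive_mul H2 H1) _.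
rewrite (psum_mulDn _ sb zI) (powR_subr1 e z0); ring.
Qed.

(** The falling factorial, which arises from differentiating a power of exponent y. *)
Definition fallp (y : R) (i : nat) : R := \prod_(j < i) (y - j%:R).

Lemma fallpS_shift y i : fallp (y + 1) i * (y + 1 - i%:R) = (y + 1) * fallp y i.
Proof.
rewrite /fallp; elim: i => [|i IH]; first by rewrite !big_ord0 subr0; ring.
rewrite !big_ord_recr/= -natr1.
rewrite [LHS](_ : _ = (\prod_(j < i) (y + 1 - j%:R)) * (y + 1 - i%:R) * (y - i%:R)).
  by rewrite IH; ring.
ring.
Qed.

Lemma pochhammerS (x : R) n : pochhammer x n.+1 = pochhammer x n * (x + n%:R).
Proof. by rewrite /pochhammer big_ord_recr. Qed.

Lemma pochhammer_gt0 (x : R) n : 0 < x -> 0 < pochhammer x n.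
Proof. by move=> x0; rewrite prodr_gt0// => i _; rewrite ltr_wpDr. Qed.

(** The Taylor coefficients of (1 - u) ^ (- tau), the term of comparison for the Gauss series. *)
Definition binc (tau : R) (n : nat) : R := pochhammer tau n / (n`!)%:R.

Lemma binc_gt0 tau n : 0 < tau -> 0 < binc tau n.
Proof. by move=> t0; rewrite divr_gt0 ?pochhammer_gt0// ltr0n fact_gt0. Qed.

Lemma bincS tau n : binc tau n.+1 * n.+1%:R = binc tau n * (n%:R + tau).
Proof.
rewrite /binc pochhammerS factS natrM; field.
by rewrite nat1r !pnatr_eq0 -lt0n fact_gt0.
Qed.

Lemma subunit_binc tau : 0 < tau -> subunit (binc tau).
Proof.
move=> t0; apply: (@subunit_ratio _ tau 0) => n _ n0.
rewrite !gtr0_norm ?binc_gt0//.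
apply: (@le_trans _ _ (binc tau n.+1 * n.+1%:R)).
  by rewrite ler_wpM2l ?(ltW (binc_gt0 _ _))// ler_nat.
by rewrite bincS mulrC.
Qed.

(** By [bincS] the sum S satisfies (1 - u) S' = tau S, so S * (1 - u) ^ tau has derivative 0 and
    keeps its value 1 at u = 0. *)
Lemma psum_binc tau z : 0 < tau -> 0 <= z < 1 ->
  psum (binc tau) z = (1 - z) `^ (- tau).
Proof.
move=> t0 /andP[z0 z1].
have sb := subunit_binc t0.
pose f u := psum (binc tau) u * (1 - u) `^ tau.
have fd u : 0 <= u <= z -> is_derive u 1 f 0.
  move=> /andP[u0 uz]; have uI : 0 <= u < 1 by rewrite u0 (le_lt_trans uz).
  have H1 := is_derive_psum sb uI.
  have u1 : 0 < 1 - u by lra.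
  have H2 : is_derive u 1 (fun u => (1 - u) `^ tau) (- (tau * (1 - u) `^ (tau - 1))).
    have := @is_derive_comp _ (fun t : R => t `^ tau) (fun t : R => 1 - t) _ _ _
      (is_derive1_powR tau u1) (is_derive_subl 1 u).
    by rewrite mulrN1.
  apply: trigger_derive (is_derive_mul H1 H2) _.
  have := psum_mulDn tau sb uI.
  rewrite [X in psum X](_ : _ = pseries_diffs (binc tau)); last first.
    by apply/funext => n; rewrite /pseries_diffs mulrC -bincS mulrC.
  set D := psum (pseries_diffs _) _ => DE.
  rewrite (powR_subr1 tau u1).
  rewrite [X in X = _](_ : _ = (1 - u) `^ (tau - 1) *
    (D - (u * D + tau * psum (binc tau) u))); last ring.
  by rewrite -DE subrr mulr0.
have [c _] := mean_value z0 fd.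
rewrite mul0r => /eqP; rewrite subr_eq0 /f subr0 powR1 mulr1 => /eqP.
have -> : psum (binc tau) 0 = 1.
  (* The partial sum of index 0 is empty; from index 1 on, they are all equal to 1. *)
  apply: cvg_lim => //; rewrite -(@cvg_shiftS R^o).
  rewrite [X in X @ _](_ : _ = cst 1); first exact: cvg_cst.
  apply/funext => n; rewrite /pseries /series/= big_nat_recl// expr0 mulr1.
  rewrite big1 ?addr0 => [|i _]; last by rewrite expr0n mulr0.
  by rewrite /binc /pochhammer big_ord0 fact0 divr1.
move=> E; rewrite powRN -[RHS]mul1r; apply: canRL (mulfK _) E.
by rewrite gt_eqF// powR_gt0//; lra.
Qed.

(* The quantities [x n * (1 + 2 C / n)] and [x n * (1 - 2 C / n)] are eventually
   nonincreasing and nondecreasing, respectively. *)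
Lemma bounded_of_small_increments (x : nat -> R) (C : R) (n0 : nat) :
  (forall n, (n0 <= n)%N -> 0 < x n) ->
  (forall n, (n0 <= n)%N -> (0 < n)%N ->
     `|x n.+1 - x n| <= C * (n%:R^-1 - n.+1%:R^-1) * x n) ->
  exists n1 m M, 0 < m /\ forall n, (n1 <= n)%N -> m <= x n <= M.
Proof.
wlog C0 : C / 0 <= C.
  move=> H x0 xn; apply: (H (Num.max C 0)) => // [|n nn n_gt0].
    by rewrite le_max lexx orbT.
  apply: le_trans (xn n nn n_gt0) _.
  rewrite ler_wpM2r ?(ltW (x0 _ nn))// ler_wpM2r ?le_max ?lexx//.
  by rewrite subr_ge0 lef_pV2 ?posrE ?ltr0n// ler_nat.
move=> x0 xn.
(* n >= 4 C means 2 C / n <= 1 / 2, which keeps 1 - 2 C / n positive. *)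
have [n2 Hn2] := natr_ge_ex (4 * C).
pose n1 := maxn 1 (maxn n0 n2).
have small n : (n1 <= n)%N -> [/\ (n0 <= n)%N, (0 < n)%N & 2 * C * n%:R^-1 <= 2^-1].
  rewrite !geq_max => /and3P[n_gt0 nn0 nn2]; split => //.
  by have := Hn2 n nn2; rewrite ler_pdivrMr ?ltr0n//; lra.
have up n : (n1 <= n)%N -> x n * (1 + 2 * C * n%:R^-1) <= x n1 * (1 + 2 * C * n1%:R^-1).
  elim: n => [|n IH]; first by rewrite leqn0 => /eqP ->.
  rewrite leq_eqVlt => /orP[/eqP ->//|]; rewrite ltnS => nn1.
  have [nn0 n_gt0 _] := small n nn1; have [_ _ s1] := small n.+1 (leqW nn1).
  apply: le_trans (IH nn1); move: s1.
  have := xn n nn0 n_gt0; have xp := x0 n nn0; have xp' := x0 n.+1 (leqW nn0).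
  have : n.+1%:R^-1 <= n%:R^-1 :> R by rewrite lef_pV2 ?posrE ?ltr0n// ler_nat.
  have : 0 < n.+1%:R^-1 :> R by rewrite invr_gt0 ltr0n.
  move: (n.+1%:R^-1) (n%:R^-1) => B A B0 BA.
  rewrite ler_norml => /andP[_ Hx] CB.
  have H1 : x n.+1 <= x n * (1 + C * (A - B)) by lra.
  have CB0 : 0 <= 2 * C * B by rewrite !mulr_ge0// ltW.
  apply: le_trans (ler_wpM2r (_ : 0 <= 1 + 2 * C * B) H1) _; first lra.
  rewrite -[leLHS]mulrA ler_wpM2l ?(ltW xp)//.
  (* The inequality at stake is (1 + C (A - B)) (1 + 2 C B) <= 1 + 2 C A; this bounds its quadratic
     term. *)
  have : C * (A - B) * (2 * C * B) <= C * (A - B) * 1.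
    rewrite ler_wpM2l ?mulr_ge0 ?subr_ge0//; lra.
  lra.
have lo n : (n1 <= n)%N -> x n1 * (1 - 2 * C * n1%:R^-1) <= x n * (1 - 2 * C * n%:R^-1).
  elim: n => [|n IH]; first by rewrite leqn0 => /eqP ->.
  rewrite leq_eqVlt => /orP[/eqP ->//|]; rewrite ltnS => nn1.
  have [nn0 n_gt0 _] := small n nn1; have [_ _ s1] := small n.+1 (leqW nn1).
  apply: le_trans (IH nn1) _; move: s1.
  have := xn n nn0 n_gt0; have xp := x0 n nn0; have xp' := x0 n.+1 (leqW nn0).
  have : n.+1%:R^-1 <= n%:R^-1 :> R by rewrite lef_pV2 ?posrE ?ltr0n// ler_nat.
  have : 0 < n.+1%:R^-1 :> R by rewrite invr_gt0 ltr0n.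
  move: (n.+1%:R^-1) (n%:R^-1) => B A B0 BA.
  rewrite ler_norml => /andP[Hx _] CB.
  have H1 : x n * (1 - C * (A - B)) <= x n.+1 by lra.
  have CB0 : 0 <= 2 * C * B by rewrite !mulr_ge0// ltW.
  apply: le_trans (ler_wpM2r (_ : 0 <= 1 - 2 * C * B) H1); last lra.
  rewrite -[leRHS]mulrA ler_wpM2l ?(ltW xp)//.
  have : 0 <= C * (A - B) * (1 + 2 * C * B).
    by rewrite !mulr_ge0 ?subr_ge0//; lra.
  lra.
have [nn0 n_gt0 s1] := small n1 (leqnn _); have xp := x0 _ nn0.
exists n1, (x n1 * (1 - 2 * C * n1%:R^-1)), (x n1 * (1 + 2 * C * n1%:R^-1)).
split; first by rewrite mulr_gt0//; lra.
move=> n nn1; have [nn0' n_gt0' s] := small n nn1; have xp' := x0 _ nn0'.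
have s0 : 0 <= 2 * C * n%:R^-1 by rewrite !mulr_ge0.
apply/andP; split.
  by apply: le_trans (lo n nn1) _; rewrite ler_piMr ?(ltW xp')//; lra.
by apply: le_trans (up n nn1); rewrite ler_peMr ?(ltW xp')//; lra.
Qed.

(** The finitely many exceptional coefficients contribute a function that is bounded on [0, 1). *)
Lemma psum_le_eventually b t (n1 : nat) : subunit b -> subunit t ->
  (forall n, (n1 <= n)%N -> b n <= t n) ->
  exists B, forall z, 0 <= z < 1 -> psum b z <= psum t z + B.
Proof.
move=> sb st bt; exists (\sum_(0 <= i < n1) `|b i - t i|) => z zI.
have [z0 z1] := andP zI.
have cb := subunit_cvg sb zI; have ct := subunit_cvg st zI.
rewrite -lerBlDl /psum -limB//; apply: limr_le; first exact: is_cvgB.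
near=> n.
rewrite [leLHS](_ : _ = \sum_(0 <= i < n) (b i * z ^+ i - t i * z ^+ i)); last by rewrite sumrB.
have nn1 : (n1 <= n)%N by near: n; exact: nbhs_infty_ge.
rewrite (big_cat_nat (n := n1))//= -[leRHS]addr0 lerD//.
  apply: ler_sum => i _; rewrite -mulrBl.
  apply: le_trans (ler_norm _) _; rewrite normrM ler_piMr//.
  by rewrite ger0_norm ?exprn_ge0// exprn_ile1// ltW.
rewrite big_nat; apply: sumr_le0 => i /andP[ni _].
by rewrite -mulrBl mulr_le0_ge0 ?exprn_ge0// subr_le0 bt.
Unshelve. all: by end_near. Qed.

End power_series.
(** * The Gauss hypergeometric series near 1 *)

Section hypergeometric.
Context {R : realType}.
Variables p q s : R.
Hypotheses (p0 : 0 < p) (q0 : 0 < q) (s0 : 0 < s).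

Definition hypc (n : nat) : R :=
  pochhammer p n * pochhammer q n / (pochhammer s n * (n`!)%:R).

Lemma hypc_gt0 n : 0 < hypc n.
Proof.
by rewrite divr_gt0 ?mulr_gt0 ?pochhammer_gt0// ltr0n fact_gt0.
Qed.

Lemma hypcS n : hypc n.+1 = hypc n * (n%:R + p) * (n%:R + q) / ((n%:R + s) * n.+1%:R).
Proof.
rewrite /hypc !pochhammerS factS natrM.
have H1 := gt_eqF (pochhammer_gt0 n s0).
have H2 : n%:R + s != 0 by rewrite gt_eqF// ltr_wpDl.
have H3 : (n`!)%:R != 0 :> R by rewrite pnatr_eq0 -lt0n fact_gt0.
by field; rewrite H3 H2 H1 nat1r pnatr_eq0.
Qed.

Lemma subunit_hypc : subunit hypc.
Proof.
move: (p0) (q0) (s0) => p0' q0' s0'.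
(* For n >= 1, (n + p) (n + q) <= n (n + p + q + p q), whence this constant. *)
apply: (@subunit_ratio _ _ (p + q + p * q) 0) => n _ n_gt0.
rewrite !gtr0_norm ?hypc_gt0// hypcS.
have n1 : 1 <= n%:R :> R by rewrite ler1n.
have ns : 0 < n%:R + s by rewrite ltr_wpDl.
have Sn : 0 < n.+1%:R :> R by rewrite ltr0n.
have c0 := hypc_gt0 n.
rewrite mulrAC ler_pdivrMr ?mulr_gt0//.
rewrite [leRHS](_ : _ = hypc n * ((n%:R + (p + q + p * q)) * ((n%:R + s) * n.+1%:R))); last ring.
rewrite [leLHS](_ : _ = hypc n * ((n%:R + p) * (n%:R + q) * n%:R)); last ring.
rewrite ler_pM2l// -[n.+1]addn1 natrD.
set x : R := n%:R in n1 ns *; clearbody x.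
apply: (@le_trans _ _ ((x * (x + (p + q + p * q))) * x)).
  rewrite ler_wpM2r//; first by rewrite (le_trans ler01).
  rewrite [leLHS](_ : _ = x * (x + (p + q)) + 1 * (p * q)); last ring.
  rewrite [leRHS](_ : _ = x * (x + (p + q)) + x * (p * q)); last ring.
  by rewrite lerD2l ler_wpM2r// mulr_ge0 ?(ltW p0) ?(ltW q0).
rewrite [leLHS](_ : _ = (x + (p + q + p * q)) * (x * x)); last ring.
have pq0 : 0 <= p * q by rewrite mulr_ge0 ?(ltW p0) ?(ltW q0).
rewrite ler_wpM2l//.
  by rewrite !addr_ge0 ?(ltW p0) ?(ltW q0)// (le_trans ler01).
have x0 : 0 <= x by lra.
by rewrite ler_pM//; lra.
Qed.

(** The i-th derivative of u ^ (n + s - 1) carries the factor fallp (n + s - 1) i; these are the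
    coefficients of the i-th derivative in u of u ^ (s - 1) 2F1. *)
Definition hypd (i n : nat) : R := fallp (n%:R + (s - 1)) i * hypc n.

Lemma hypdS i : hypd i.+1 = (fun n => (n%:R + (s - 1 - i%:R)) * hypd i n).
Proof.
by apply/funext => n; rewrite /hypd /fallp big_ord_recr/=; ring.
Qed.

Lemma hypd0 : hypd 0 = hypc.
Proof. by apply/funext => n; rewrite /hypd /fallp big_ord0 mul1r. Qed.

Lemma subunit_hypd i : subunit (hypd i).
Proof.
elim: i => [|i IH]; first by rewrite hypd0; exact: subunit_hypc.
by rewrite hypdS; exact: subunit_mulDn.
Qed.

(* Derivatives in x of u^(s-1) 2F1(p, q; s; u), where u = 1 - x. *)
Definition hyppsi (i : nat) (x : R) : R :=
  (-1) ^+ i * ((1 - x) `^ (s - 1 - i%:R) * psum (hypd i) (1 - x)).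

Lemma hyppsi_chain : derivative_chain 1 hyppsi.
Proof.
move=> i x /andP[x0 x1]; have uI : 0 < 1 - x < 1 by apply/andP; split; lra.
have H1 := is_derive_powR_psum (s - 1 - i%:R) (subunit_hypd i) uI.
have H2 := @is_derive_comp _ (fun u : R => u `^ (s - 1 - i%:R) * psum (hypd i) u)
  (fun t : R => 1 - t) x _ _ H1 (is_derive_subl 1 x).
apply: trigger_derive (is_derive_scale ((-1) ^+ i) H2) _.
rewrite /hyppsi hypdS exprS -natr1 opprD addrA; ring.
Qed.

Variable N : nat.
Let tau := N%:R - (s - p - q).
Hypothesis tau0 : 0 < tau.

(** For j < N <= n each factor n + s - 1 - j is at least s; the coefficients of index below N may be
    negative. *)
Lemma hypd_gt0 n : (N <= n)%N -> 0 < hypd N n.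
Proof.
move: (p0) (q0) (s0) (tau0) => p0' q0' s0' tau0'.
move=> Nn; rewrite mulr_gt0 ?hypc_gt0// prodr_gt0// => j _.
have : j.+1%:R <= n%:R :> R by rewrite ler_nat (leq_trans _ Nn).
rewrite -natr1; lra.
Qed.

(* The ratio of consecutive values of [hypd N n / binc tau n] is [1 + O(1 / n ^ 2)],
   because [tau] is chosen so that the terms in [1 / n] cancel. *)
Lemma hypd_binc : exists n1 m M, 0 < m /\
  forall n, (n1 <= n)%N -> m * binc tau n <= hypd N n <= M * binc tau n.
Proof.
move: (p0) (q0) (s0) (tau0) => p0' q0' s0' tau0'.
pose x n := hypd N n / binc tau n.
(* The ratio of [x n.+1] to [x n] is (n + p) (n + q) / ((n + s - N) (n + tau)). As s - N + tau = p +
   q, numerator and denominator differ by the constant K. *)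
pose K := p * q - (s - N%:R) * tau.
have [n nn|n nn n_gt0|n1 [m [M [m0 H]]]] :=
  (* For n >= 2 N the denominator is at least n (n + 1) / 4, and 4 / (n (n + 1)) telescopes. *)
  @bounded_of_small_increments _ x (4 * `|K|) (2 * N).
- by rewrite divr_gt0 ?binc_gt0// hypd_gt0// (leq_trans _ nn)// leq_pmull.
- have Nn : (N <= n)%N by rewrite (leq_trans _ nn)// leq_pmull.
  have nN : 2 * N%:R <= n%:R :> R by rewrite -natrM ler_nat.
  have n1 : 1 <= n%:R :> R by rewrite ler1n.
  have Npos : 0 <= N%:R :> R by [].
  have ns : 0 < n%:R + s by rewrite ltr_wpDl.
  have nsN : n%:R / 2 <= n%:R + s - N%:R by lra.
  have nt : (n%:R + 1) / 2 <= n%:R + tau by lra.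
  have Sn : n.+1%:R = n%:R + 1 :> R by rewrite -natr1.
  have xn : x n.+1 - x n = x n * (K / ((n%:R + s - N%:R) * (n%:R + tau))).
    rewrite /x /hypd hypcS.
    have -> : binc tau n.+1 = binc tau n * (n%:R + tau) / n.+1%:R.
      by rewrite -bincS mulfK// pnatr_eq0.
    have -> : fallp (n.+1%:R + (s - 1)) N =
        (n%:R + s) * fallp (n%:R + (s - 1)) N / (n%:R + s - N%:R).
      apply: canRL (mulfK _) _; first by rewrite gt_eqF//; lra.
      have E1 : n%:R + (s - 1) + 1 = n%:R + s by ring.
      have E2 : n.+1%:R + (s - 1) = n%:R + s by rewrite Sn; ring.
      by have := fallpS_shift (n%:R + (s - 1)) N; rewrite E1 E2.
    have b0 := binc_gt0 n tau0.
    have := fallp (n%:R + (s - 1)) N; have := hypc n => h f.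
    rewrite Sn /K /tau; field.
    by rewrite /tau in nt b0; rewrite !gt_eqF//=; lra.
  have x0 : 0 < x n by rewrite divr_gt0 ?binc_gt0// hypd_gt0.
  rewrite xn normrM (gtr0_norm x0) mulrC ler_pM2r// normrM normfV -!mulrA.
  rewrite [leRHS]mulrCA ler_wpM2l//.
  rewrite gtr0_norm; last by rewrite mulr_gt0; lra.
  rewrite Sn; have -> : 4 * (n%:R^-1 - (n%:R + 1)^-1) = ((n%:R / 2) * ((n%:R + 1) / 2))^-1 :> R.
    by field; rewrite !gt_eqF//=; lra.
  by rewrite lef_pV2 ?posrE ?mulr_gt0 ?ler_pM//; lra.
exists n1, m, M; split => // n /H; rewrite /x.
by rewrite ler_pdivlMr ?ler_pdivrMr ?binc_gt0.
Qed.

Lemma psum_scale (m : R) (b : nat -> R) z : subunit b -> 0 <= z < 1 ->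
  psum (fun n => m * b n) z = m * psum b z.
Proof.
move=> sb zI; rewrite /psum.
have -> : m * limn (pseries b z) = limn (series (m *: (fun i => b i * z ^+ i : R^o))).
  by apply/esym; apply: lim_seriesZ; exact: subunit_cvg.
congr (limn (series _)); apply/funext => n.
by transitivity (m * (b n * z ^+ n)); first by rewrite mulrA.
Qed.

Lemma subunit_scale (m : R) (b : nat -> R) : subunit b -> subunit (fun n => m * b n).
Proof.
move=> sb z /sb[M HM]; exists (`|m| * M) => n.
by rewrite normrM -mulrA ler_wpM2l.
Qed.

(** x ^ (- tau) is the sum of the comparison series at 1 - x, and the comparison of coefficients,
    valid from some index on, costs the additive constant B. *)
Lemma psum_hypd_bounds : exists m M B, [/\ 0 < m, 0 <= M, 0 <= B &
  forall x, 0 < x < 1 ->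
    m * x `^ (- tau) - B <= psum (hypd N) (1 - x) <= M * x `^ (- tau) + B].
Proof.
have [n1 [m [M [m0 H]]]] := hypd_binc.
have sb := subunit_binc tau0.
have [|B1 HB1] := psum_le_eventually (n1 := n1) (subunit_scale m sb) (subunit_hypd N).
  by move=> n /H /andP[].
have [|B2 HB2] := psum_le_eventually (n1 := n1) (subunit_hypd N) (subunit_scale M sb).
  by move=> n /H /andP[].
exists m, `|M|, (Num.max `|B1| `|B2|); split=> //.
move=> x /andP[x0 x1]; have uI : 0 <= 1 - x < 1 by apply/andP; split; lra.
have := HB1 _ uI; have := HB2 _ uI; rewrite !psum_scale// psum_binc// subKr.
have xp : 0 <= x `^ (- tau) by rewrite powR_ge0.
have BB1 : B1 <= Num.max `|B1| `|B2| by rewrite le_max ler_norm.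
have BB2 : B2 <= Num.max `|B1| `|B2| by rewrite le_max ler_norm orbT.
have MM : M * x `^ (- tau) <= `|M| * x `^ (- tau) by rewrite ler_wpM2r// ler_norm.
move=> H2 H1; apply/andP; split; lra.
Qed.

Lemma powR_bounds (e : R) : exists m M, 0 < m /\
  forall u, 1 / 2 <= u <= 1 -> m <= u `^ e <= M.
Proof.
have h0 : 0 < (1 / 2 : R) by lra.
have he : 0 < (1 / 2 : R) `^ e by exact: powR_gt0.
exists (Num.min 1 ((1 / 2) `^ e)), (Num.max 1 ((1 / 2) `^ e)).
split; first by rewrite lt_min ltr01.
move=> u /andP[u0 u1]; have up : 0 < u by lra.
rewrite ge_min le_max; have [e0|/ltW e0] := leP 0 e; apply/andP; split.
- by rewrite ge0_ler_powR ?nnegrE ?orbT ?(ltW h0) ?(ltW up).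
- by rewrite -[leRHS](one_powR e) ge0_ler_powR ?nnegrE ?(ltW up).
- by rewrite -[leLHS](one_powR e) le0_ger_powR.
- by rewrite le0_ger_powR ?orbT.
Qed.

Lemma hyppsi_upper : exists C, forall x, 0 < x < 1 / 2 ->
  `|hyppsi N x| <= C * x `^ (- tau).
Proof.
move: (p0) (q0) (s0) (tau0) => p0' q0' s0' tau0'.
have [m [M [B [m0 M0 B0 H]]]] := psum_hypd_bounds.
have [m' [M' [m'0 H']]] := powR_bounds (s - 1 - N%:R).
exists (M' * (M + B)) => x /andP[x0 x1].
have /H/andP[H1 H2] : 0 < x < 1 by apply/andP; split; lra.
have /H'/andP[H3 H4] : 1 / 2 <= 1 - x <= 1 by apply/andP; split; lra.
rewrite !normrM normrX normrN1 expr1n mul1r -mulrA ler_pM ?normr_ge0//.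
  by rewrite ger0_norm ?powR_ge0.
have x_ge1 : 1 <= x `^ (- tau).
  by rewrite -[leLHS](one_powR (- tau)) le0_ger_powR ?oppr_le0 ?(ltW tau0)//; lra.
have : B <= B * x `^ (- tau) by rewrite ler_peMr.
have : 0 <= m * x `^ (- tau) by rewrite mulr_ge0 ?powR_ge0 ?(ltW m0).
have : 0 <= M * x `^ (- tau) by rewrite mulr_ge0 ?powR_ge0.
by move=> ? ? ?; rewrite ler_norml; apply/andP; split; lra.
Qed.

Lemma hyppsi_lower : exists c x1, [/\ 0 < c, 0 < x1 < 1 & forall x, 0 < x < x1 ->
  c * x `^ (- tau) <= (-1) ^+ N * hyppsi N x].
Proof.
move: (p0) (q0) (s0) (tau0) => p0' q0' s0' tau0'.
have [m [M [B [m0 M0 B0 H]]]] := psum_hypd_bounds.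
have [m' [M' [m'0 H']]] := powR_bounds (s - 1 - N%:R).
(* Once x ^ tau <= y, the constant B is at most m / 2 * x ^ (- tau), and half of the main term
   survives. *)
pose y := m / (2 * (B + 1)).
have y0 : 0 < y by rewrite divr_gt0// mulr_gt0//; lra.
pose x1 := Num.min (1 / 2) (y `^ tau^-1).
exists (m' * (m / 2)), x1; split.
- by rewrite mulr_gt0// divr_gt0.
- rewrite lt_min powR_gt0// andbT gt_min; apply/andP; split; first lra.
  by apply/orP; left; lra.
move=> x /andP[x0]; rewrite lt_min => /andP[xh xy].
have /H/andP[H1 H2] : 0 < x < 1 by apply/andP; split; lra.
have /H'/andP[H3 H4] : 1 / 2 <= 1 - x <= 1 by apply/andP; split; lra.
rewrite /hyppsi [leRHS]mulrA -exprMn mulrNN mul1r expr1n mul1r -mulrA.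
have xt : x `^ tau <= y.
  have -> : y = (y `^ tau^-1) `^ tau.
    by rewrite -powRrM mulVf ?gt_eqF// powRr1// ltW.
  by rewrite ge0_ler_powR ?nnegrE ?powR_ge0 ?(ltW tau0) ?(ltW x0) ?(ltW xy).
have HB : B <= m / 2 * x `^ (- tau).
  rewrite powRN ler_pdivlMr ?powR_gt0//.
  apply: (@le_trans _ _ ((B + 1) * y)); last first.
    by rewrite /y le_eqVlt; apply/orP; left; apply/eqP; field; rewrite gt_eqF//; lra.
  by rewrite ler_pM ?powR_ge0//; lra.
by rewrite ler_pM ?(ltW m'0) ?mulr_ge0 ?powR_ge0 ?divr_ge0 ?(ltW m0)//; lra.
Qed.

End hypergeometric.
(** * Functions on R^d with a radial singularity at the origin *)

Lemma powR_small (R : realType) (delta eps : R) : 0 < delta -> 0 < eps ->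
  exists t1, 0 < t1 /\ forall t, 0 <= t < t1 -> t `^ delta <= eps.
Proof.
move=> d0 e0; exists (eps `^ delta^-1); split; first exact: powR_gt0.
move=> t /andP[t0 t1]; have -> : eps = (eps `^ delta^-1) `^ delta.
  by rewrite -powRrM mulVf ?gt_eqF// powRr1// ltW.
by rewrite ge0_ler_powR ?nnegrE ?powR_ge0 ?(ltW d0) ?(ltW t1).
Qed.

Lemma is_derive_continuous (R : realType) (g : R -> R) (x l eps : R) :
  is_derive x 1 g l -> 0 < eps ->
  exists t1, 0 < t1 /\ forall t, `|t| < t1 -> `|g (x + t) - g x| <= eps.
Proof.
move=> [gd _] e0.
have /cvgrPdist_le/(_ eps e0) : {for x, continuous g}.
  exact/differentiable_continuous/derivable1_diffP.
case/nbhs_ballP => t1 /= t10 H; exists t1; split => // t tt.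
rewrite distrC; apply: H; rewrite -ball_normE/=.
by rewrite opprD addrA subrr sub0r normrN.
Qed.

Lemma is_derive0_of_bound (R : realType) (f : R -> R) (K delta t0 : R) :
  0 < delta -> 0 < t0 -> f 0 = 0 ->
  (forall t, `|t| < t0 -> `|f t| <= K * `|t| * `|t| `^ delta) ->
  is_derive (0 : R) 1 f 0.
Proof.
move=> d0 t0_gt0 f0 H.
have cv : h^-1 *: (f (h *: 1 + 0) - f 0) @[h --> 0^'] --> (0 : R).
  apply/cvgrPdist_le => eps e0; rewrite near_withinE.
  have [|t1 [t1_gt0 Ht1]] := @powR_small _ delta (eps / (`|K| + 1)) d0.
    by rewrite divr_gt0// ltr_wpDl.
  have : \forall t \near (0 : R), `|t| < Num.min t0 t1.
    by apply: near_norm_lt; rewrite normr0 lt_min t0_gt0.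
  apply: filterS => h; rewrite lt_min => /andP[ht0 ht1] h0.
  rewrite sub0r normrN f0 subr0 addr0 /GRing.scale/= mulr1 mulrC normf_div.
  rewrite ler_pdivrMr ?normr_gt0// (le_trans (H h ht0))//.
  rewrite mulrAC ler_wpM2r//.
  have := Ht1 `|h|; rewrite normr_ge0/= => /(_ ht1).
  rewrite ler_pdivlMr ?ltr_wpDl// mulrDr mulr1.
  have : K * `|h| `^ delta <= `|K| * `|h| `^ delta by rewrite ler_wpM2r ?powR_ge0 ?ler_norm.
  have := powR_ge0 `|h| delta; rewrite [`|K| * _]mulrC; lra.
apply: DeriveDef; first by apply/cvg_ex; exists 0.
exact: cvg_lim.
Qed.

Section smooth_class.
Context {R : realType} {d : nat}.
Local Notation V := 'rV[R]_d.
Implicit Types (f g : V -> R) (h v : V).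

Definition dot v h : R := \sum_(i < d) v ord0 i * h ord0 i.

(** Derivatives along lines are what both sides use: the radial function is a restriction to a line,
    and [ms_derivative] is directional. *)
Definition line_derive f h v (l : R) := is_derive (0 : R) 1 (fun t : R => f (h + t *: v)) l.

Lemma line_derive_shift f h v (t0 l : R) : line_derive f (h + t0 *: v) v l ->
  is_derive t0 1 (fun t : R => f (h + t *: v)) l.
Proof.
rewrite /line_derive => H.
have H' : is_derive (t0 - t0) 1 (fun t : R => f (h + t0 *: v + t *: v)) l by rewrite subrr.
have := @is_derive_comp _ (fun t : R => f (h + t0 *: v + t *: v)) (fun t : R => t - t0) t0 _ _
  H' (is_derive_addr t0 (- t0)).
rewrite mulr1; congr (is_derive _ _ _ _); apply/funext => t.
by rewrite -addrA -scalerDl [t0 + _]addrC subrK.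
Qed.

Lemma dot_lin v h (t : R) w : dot v (h + t *: w) = dot v h + t * dot v w.
Proof.
rewrite /dot mulr_sumr -big_split/=; apply: eq_bigr => i _.
by rewrite !mxE; ring.
Qed.

Lemma dotC v h : dot v h = dot h v.
Proof. by apply: eq_bigr => i _; rewrite mulrC. Qed.

Lemma dot_ge0 h : 0 <= dot h h.
Proof. by apply: sumr_ge0 => i _; rewrite -expr2 sqr_ge0. Qed.

Lemma dot_eq0 h : dot h h = 0 -> h = 0.
Proof.
move=> /eqP; rewrite psumr_eq0 => [/allP H|i _]; last by rewrite -expr2 sqr_ge0.
apply/rowP => i; rewrite !mxE.
by have := H i (mem_index_enum _); rewrite -expr2 sqrf_eq0 => /eqP.
Qed.

(* Polynomial functions all of whose monomials have degree at least [j]. *)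
Inductive mono : nat -> (V -> R) -> Prop :=
| mono_const c : mono 0 (fun=> c)
| mono_dot v : mono 1 (dot v)
| mono_add j f g : mono j f -> mono j g -> mono j (fun h => f h + g h)
| mono_mul i j f g : mono i f -> mono j g -> mono (i + j) (fun h => f h * g h)
| mono_weaken i j f : (i <= j)%N -> mono j f -> mono i f.

Lemma line_derive_dot w h v : line_derive (dot w) h v (dot w v).
Proof.
rewrite /line_derive.
have -> : (fun t : R => dot w (h + t *: v)) = (fun t : R => dot w v * t + dot w h).
  by apply/funext => t; rewrite dot_lin addrC mulrC.
have H := is_derive_scale (dot w v) (is_derive_id (0 : R) 1).
by have := @is_derive_comp _ (fun t : R => t + dot w h) _ _ _ _ (is_derive_addr _ _) H;
  rewrite mul1r mulr1.
Qed.

Lemma mono_derive j f : mono j f -> forall v,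
  exists f', mono j.-1 f' /\ forall h, line_derive f h v (f' h).
Proof.
elim=> {j f} [c|w|j f g mf IHf mg IHg|i j f g mf IHf mg IHg|i j f ij mf IH] v.
- exists (fun=> 0); split; first exact: mono_const.
  by move=> h; exact: is_derive_cst.
- exists (fun=> dot w v); split; first exact: mono_const.
  by move=> h; exact: line_derive_dot.
- have [f' [mf' df]] := IHf v; have [g' [mg' dg]] := IHg v.
  exists (fun h => f' h + g' h); split; first exact: mono_add.
  by move=> h; apply: is_derive_add; [exact: df | exact: dg].
- have [f' [mf' df]] := IHf v; have [g' [mg' dg]] := IHg v.
  exists (fun h => f h * g' h + g h * f' h); split.
    apply: mono_add.
      by apply: mono_weaken (mono_mul mf mg'); lia.
    by apply: mono_weaken (mono_mul mg mf'); lia.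
  move=> h; have := is_derive_mul (df h) (dg h).
  by rewrite scale0r addr0.
- have [f' [mf' df]] := IH v; exists f'; split => //.
  by apply: mono_weaken mf'; lia.
Qed.

Lemma mono_bound j f : mono j f -> forall v,
  exists C, 0 <= C /\ forall t : R, `|t| <= 1 -> `|f (t *: v)| <= C * `|t| ^+ j.
Proof.
elim=> {j f} [c|w|j f g mf IHf mg IHg|i j f g mf IHf mg IHg|i j f ij mf IH] v.
- by exists `|c|; split => // t _; rewrite expr0 mulr1.
- exists `|dot w v|; split => // t _.
  have := dot_lin w 0 t v; rewrite add0r => ->.
  rewrite [dot w 0]big1 ?add0r; first by rewrite normrM mulrC.
  by move=> i _; rewrite mxE mulr0.
- have [A [A0 HA]] := IHf v; have [B [B0 HB]] := IHg v.
  exists (A + B); split; first exact: addr_ge0.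
  move=> t t1; rewrite (le_trans (ler_normD _ _))// mulrDl.
  by apply: lerD; [exact: HA | exact: HB].
- have [A [A0 HA]] := IHf v; have [B [B0 HB]] := IHg v.
  exists (A * B); split; first exact: mulr_ge0.
  move=> t t1; rewrite normrM exprD mulrACA.
  by apply: ler_pM => //; [exact: HA | exact: HB].
- have [A [A0 HA]] := IH v; exists A; split => // t t1.
  apply: le_trans (HA t t1) _; rewrite ler_wpM2l//.
  by apply: ler_wiXn2l.
Qed.

(** In the application [phi i] is the i-th derivative of the non-polynomial part. Its value 0 at 0
    is a convention, by which the terms of [smooth] take their limits at the origin. *)
Variables (w : R) (phi : nat -> R -> R) (k : nat) (e C x1 : R).
Hypotheses (w0 : 0 < w) (x1_gt0 : 0 < x1) (C0 : 0 <= C) (ke : k%:R < 2 * e).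
Hypothesis phi_chain : derivative_chain x1 phi.
Hypothesis phi_bound : forall i (x : R), (i <= k)%N -> 0 < x < x1 ->
  `|phi i x| <= C * x `^ (e - i%:R).
Hypothesis phi0 : forall i, phi i 0 = 0.

(** With w = 1 / a ^ 2 this is the variable x of the chains. *)
Definition quad h := w * dot h h.

Lemma quad_ge0 h : 0 <= quad h.
Proof. by rewrite mulr_ge0 ?dot_ge0 ?(ltW w0). Qed.

Lemma quad_eq0 h : quad h = 0 -> h = 0.
Proof. by move=> /eqP; rewrite mulf_eq0 gt_eqF//= => /eqP/dot_eq0. Qed.

Lemma quad0 : quad 0 = 0.
Proof. by rewrite /quad /dot big1 ?mulr0// => i _; rewrite mxE mulr0. Qed.

Lemma quadZ (t : R) v : quad (t *: v) = t ^+ 2 * quad v.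
Proof.
rewrite /quad /dot !mulr_sumr; apply: eq_bigr => i _.
by rewrite !mxE; ring.
Qed.

Lemma mono_quad : mono 2 quad.
Proof.
rewrite (_ : quad = fun h => w * dot h h)//.
apply: (mono_mul (mono_const w) (j := 2)).
have H : forall s : seq 'I_d, mono 2 (fun h => \sum_(i <- s) h ord0 i * h ord0 i).
  elim=> [|i s IH].
    rewrite (_ : (fun h => _) = fun=> 0); last by apply/funext => h; rewrite big_nil.
    rewrite (_ : (fun=> 0) = fun h => dot 0 h * dot 0 h).
      exact: (mono_mul (mono_dot 0) (mono_dot 0)).
    apply/funext => h; rewrite [dot 0 h]big1 ?mul0r// => i _.
    by rewrite mxE mul0r.
  rewrite (_ : (fun h => _) = fun h => dot (delta_mx ord0 i) h * dot (delta_mx ord0 i) h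
     + \sum_(i <- s) h ord0 i * h ord0 i).
    by apply: mono_add => //; exact: (mono_mul (mono_dot _) (mono_dot _)).
  apply/funext => h; rewrite big_cons.
  have -> // : dot (delta_mx ord0 i) h = h ord0 i.
  rewrite /dot (bigD1 i)//= mxE !eqxx mul1r big1 ?addr0// => j ji.
  by rewrite mxE (negbTE ji) andbF mul0r.
exact: H.
Qed.

Lemma line_derive_quad h v : line_derive quad h v (2 * w * dot v h).
Proof.
rewrite /line_derive.
have -> : (fun t : R => quad (h + t *: v)) =
    (fun t : R => w * (dot v v * (t * t) + (2 * dot v h * t + dot h h))).
  apply/funext => t; rewrite /quad dot_lin dotC dot_lin (dotC (h + t *: v)) dot_lin (dotC h v).
  ring.
have I := is_derive_id (0 : R) 1.
have H1 := is_derive_scale (dot v v) (is_derive_mul I I).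
have Hc : is_derive (0 : R) 1 (fun=> dot h h) 0 by exact: is_derive_cst.
have H2 := is_derive_add (is_derive_scale (2 * dot v h) I) Hc.
apply: trigger_derive (is_derive_scale w (is_derive_add H1 H2)) _.
rewrite /=; ring.
Qed.

(* Functions that can be differentiated [n] more times along lines: since
   [P h = O(|h| ^ j)] and [phi i x = O(x ^ (e - i))] with [k < 2 e], the inequality
   [n + 2 i <= j + k] makes the singular terms [o(|h| ^ n)] at the origin. *)
Inductive smooth : nat -> (V -> R) -> Prop :=
| smooth_mono n j P : mono j P -> smooth n P
| smooth_term n i j P : mono j P -> (i + n <= k)%N -> (n + i.*2 <= j + k)%N ->
    smooth n (fun h => P h * phi i (quad h))
| smooth_add n f g : smooth n f -> smooth n g -> smooth n (fun h => f h + g h).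

Lemma line_derive_term i P P' h v : 0 < quad h < x1 -> line_derive P h v (P' h) ->
  line_derive (fun h => P h * phi i (quad h)) h v
    (P' h * phi i (quad h) + (P h * (2 * w * dot v h)) * phi i.+1 (quad h)).
Proof.
move=> qh dP.
have qh' : 0 < quad (h + 0 *: v) < x1 by rewrite scale0r addr0.
have H := @is_derive_comp _ (phi i) (fun t : R => quad (h + t *: v)) 0 _ _
  (phi_chain i qh') (line_derive_quad h v).
apply: trigger_derive (is_derive_mul dP H) _.
by rewrite scale0r addr0; ring.
Qed.

(** |t| ^ j * (t ^ 2) ^ (e - i) has exponent j + 2 e - 2 i >= n + (2 e - k); the positive surplus 2
    e - k makes the term o(|t| ^ n). *)
Lemma term_bound n i j P v : mono j P -> (i <= k)%N -> (n + i.*2 <= j + k)%N ->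
  exists K t0, 0 < t0 /\ forall t : R, `|t| < t0 ->
    `|P (t *: v) * phi i (quad (t *: v))| <= K * `|t| ^+ n * `|t| `^ (2 * e - k%:R).
Proof.
move=> mP ik nij; have [A [A0 HA]] := mono_bound mP v.
have [qv|qv] := eqVneq (quad v) 0.
  exists 0, 1; split => // t _.
  by rewrite (quad_eq0 qv) scaler0 quad0 phi0 mulr0 normr0 !mul0r.
have qv0 : 0 < quad v by rewrite lt_neqAle eq_sym qv quad_ge0.
exists (A * (C * quad v `^ (e - i%:R))), (Num.min 1 (Num.sqrt (x1 / quad v))).
split; first by rewrite lt_min ltr01 sqrtr_gt0 divr_gt0.
move=> t; rewrite lt_min => /andP[t1 ts].
have [->|t_neq0] := eqVneq t 0.
  rewrite scale0r quad0 phi0 mulr0 normr0.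
  by rewrite !mulr_ge0 ?exprn_ge0 ?powR_ge0.
have t_gt0 : 0 < `|t| by rewrite normr_gt0.
have q0 : 0 < quad (t *: v) < x1.
  rewrite quadZ mulr_gt0 ?exprn_even_gt0//= -ltr_pdivlMr//.
  rewrite -real_normK ?num_real// -[ltRHS]sqr_sqrtr ?divr_ge0 ?(ltW x1_gt0) ?(ltW qv0)//.
  by rewrite ltrXn2r// ?nnegrE// sqrtr_ge0.
rewrite normrM.
have Hp := phi_bound ik q0.
have HP := HA t (ltW t1).
apply: le_trans (ler_pM (normr_ge0 _) (normr_ge0 _) HP Hp) _.
rewrite quadZ powRM ?sqr_ge0 ?(ltW qv0)//.
rewrite -[t ^+ 2]real_normK ?num_real// -[`|t| ^+ 2]powR_mulrn// -powRrM.
rewrite -[`|t| ^+ j]powR_mulrn// -[`|t| ^+ n]powR_mulrn//.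
rewrite [leLHS](_ : _ = A * (C * quad v `^ (e - i%:R)) *
   (`|t| `^ j%:R * `|t| `^ (2%:R * (e - i%:R)))); last ring.
rewrite -[leRHS]mulrA ler_wpM2l ?mulr_ge0 ?powR_ge0//.
have tI : `|t| != 0 by rewrite gt_eqF.
rewrite -!powRD ?tI ?implybT// ger_powR ?t_gt0 ?(ltW t1)//.
have : (n + i.*2)%:R <= (j + k)%:R :> R by rewrite ler_nat.
rewrite -muln2 !natrD natrM; lra.
Qed.

(** Off the origin, the product rule either lowers the degree j by one or raises both i and j by
    one; when n drops by one, both outcomes respect the two inequalities of [smooth_term]. At the
    origin, [term_bound] with exponent 1 gives derivative 0. *)
Lemma smooth_derive n f : smooth n.+1 f -> forall v, exists f', smooth n f' /\
  forall h, quad h < x1 -> line_derive f h v (f' h).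
Proof.
move En : n.+1 => m sf; elim: sf n En => {m f}
  [m j P mP|m i j P mP ik mij|m f g sf IHf sg IHg] n En v; subst m.
- have [P' [mP' dP]] := mono_derive mP v.
  by exists P'; split => //; exact: smooth_mono mP'.
- have [P' [mP' dP]] := mono_derive mP v.
  exists (fun h => P' h * phi i (quad h) + (P h * (2 * w * dot v h)) * phi i.+1 (quad h)).
  split.
    apply: smooth_add; first by apply: smooth_term mP' _ _; lia.
    have m1 := mono_mul (mono_const (2 * w)) (mono_dot v).
    by apply: smooth_term (mono_mul mP m1) _ _; lia.
  move=> h qh; have [q0|q0] := eqVneq (quad h) 0; last first.
    apply: line_derive_term; last exact: dP.
    by rewrite qh lt_neqAle eq_sym q0 quad_ge0.
  rewrite q0 !phi0 !mulr0 addr0 (quad_eq0 q0) /line_derive.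
  have ik' : (i <= k)%N by lia.
  have ij : (1 + i.*2 <= j + k)%N by lia.
  have [K [t0 [t0_gt0 H]]] := term_bound v mP ik' ij.
  apply: (@is_derive0_of_bound _ _ K (2 * e - k%:R) t0) => //.
  + by rewrite subr_gt0.
  + by rewrite scale0r addr0 quad0 phi0 mulr0.
  + by move=> t /H; rewrite add0r.
- have [f' [sf' df]] := IHf _ erefl v; have [g' [sg' dg]] := IHg _ erefl v.
  exists (fun h => f' h + g' h); split; first exact: smooth_add.
  by move=> h qh; apply: is_derive_add; [exact: df | exact: dg].
Qed.

Lemma line_derive_continuous f h v l eps : line_derive f h v l -> 0 < eps ->
  exists t1, 0 < t1 /\ forall t : R, `|t| < t1 -> `|f (h + t *: v) - f h| <= eps.
Proof.
move=> df e0; have [t1 [t1_gt0 H]] := is_derive_continuous df e0.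
exists t1; split => // t /H; by rewrite add0r scale0r addr0.
Qed.

Lemma smooth_continuous n f : smooth n f -> forall h v eps, quad h < x1 -> 0 < eps ->
  exists t1, 0 < t1 /\ forall t : R, `|t| < t1 -> `|f (h + t *: v) - f h| <= eps.
Proof.
elim=> {n f} [n j P mP|n i j P mP ik nij|n f g sf IHf sg IHg] h v eps qh e0.
- have [P' [mP' dP]] := mono_derive mP v.
  exact: line_derive_continuous (dP h) e0.
- have [q0|q0] := eqVneq (quad h) 0; last first.
    have [P' [mP' dP]] := mono_derive mP v.
    apply: line_derive_continuous (line_derive_term i _ (dP h)) e0.
    by rewrite qh lt_neqAle eq_sym q0 quad_ge0.
  have ik' : (i <= k)%N by lia.
  have ij : (0 + i.*2 <= j + k)%N by lia.
  have [K [t0 [t0_gt0 H]]] := term_bound v mP ik' ij.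
  have d0 : 0 < 2 * e - k%:R by rewrite subr_gt0.
  have [|t1 [t1_gt0 Ht1]] := @powR_small _ _ (eps / (`|K| + 1)) d0.
    by rewrite divr_gt0// ltr_wpDl.
  exists (Num.min t0 t1); split; first by rewrite lt_min t0_gt0.
  move=> t; rewrite lt_min => /andP[tt0 tt1].
  rewrite (quad_eq0 q0) quad0 phi0 mulr0 subr0 add0r (le_trans (H t tt0))//.
  rewrite expr0 mulr1; have := Ht1 `|t|; rewrite normr_ge0/= => /(_ tt1).
  rewrite ler_pdivlMr ?ltr_wpDl// mulrDr mulr1.
  have : K * `|t| `^ (2 * e - k%:R) <= `|K| * `|t| `^ (2 * e - k%:R).
    by rewrite ler_wpM2r ?powR_ge0 ?ler_norm.
  have := powR_ge0 `|t| (2 * e - k%:R); rewrite [`|K| * _]mulrC; lra.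
- have e20 : 0 < eps / 2 by rewrite divr_gt0.
  have [a [a0 Ha]] := IHf h v _ qh e20; have [b [b0 Hb]] := IHg h v _ qh e20.
  exists (Num.min a b); split; first by rewrite lt_min a0.
  move=> t; rewrite lt_min => /andP[/Ha Hf /Hb Hg].
  rewrite opprD addrACA (le_trans (ler_normD _ _))//; lra.
Qed.

Lemma smooth_opp n f : smooth n f -> smooth n (fun h => - f h).
Proof.
elim=> {n f} [n j P mP|n i j P mP ik nij|n f g sf IHf sg IHg].
- apply: (@smooth_mono n j).
  rewrite (_ : (fun h => _) = (fun h => (-1) * P h)); last by apply/funext => h; rewrite mulN1r.
  exact: mono_mul (mono_const (-1)) mP.
- rewrite (_ : (fun h => _) = fun h => ((-1) * P h) * phi i (quad h)).
    exact: smooth_term (mono_mul (mono_const (-1)) mP) ik nij.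
  by apply/funext => h; rewrite mulN1r mulNr.
- rewrite (_ : (fun h => _) = fun h => - f h + - g h); last by apply/funext => h; rewrite opprD.
  exact: smooth_add.
Qed.

Lemma smooth_weaken m n f : (m <= n)%N -> smooth n f -> smooth m f.
Proof.
move=> mn sf; elim: sf mn => {n f} [n j P mP|n i j P mP ik nij|n f g sf IHf sg IHg] mn.
- exact: smooth_mono mP.
- apply: smooth_term mP _ _; first by apply: leq_trans ik; rewrite leq_add2l.
  by apply: leq_trans nij; rewrite leq_add2r.
- by apply: smooth_add; [exact: IHf | exact: IHg].
Qed.

Lemma smooth_times_derivable n (F : V -> R) v (f : R -> R) (rho : R) :
  smooth n F -> (forall r : R, `|r| < rho -> quad (r *: v) < x1) ->
  (forall r : R, `|r| < rho -> f r = F (r *: v)) ->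
  forall r : R, `|r| < rho -> times_derivable n f r.
Proof.
move=> + qv; elim: n F f => [//|n IH] F f sF fF.
have [F' [sF' dF]] := smooth_derive sF v.
have fd (r : R) : `|r| < rho -> is_derive r 1 f (F' (r *: v)).
  move=> rr; have H : line_derive F (0 + r *: v) v (F' (r *: v)).
    by rewrite add0r; apply: dF; exact: qv.
  apply: near_eq_is_derive (line_derive_shift H).
  have nr := near_norm_lt rr.
  by near=> y; rewrite add0r fF//; near: y.
apply: times_derivableS_ball => r rr; have [fr1 fr2] := fd r rr; split => //.
apply: (IH F') => // y yy; rewrite derive1E; exact: (@derive_val _ _ _ _ _ _ _ (fd y yy)).
Unshelve. all: by end_near. Qed.

End smooth_class.
(** * Square-integrable random variables *)

Section square_integrable.
Context {disp : measure_display} {T : measurableType disp} {R : realType}.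
Variable P : probability T R.
Implicit Types (X Y Z : T -> R).

Local Notation L2 X := ((X : T -> R) \in Lfun P 2%:E).

Definition ip X Y : R := \int[P]_w (X w * Y w).

Lemma L2_measurable X : L2 X -> measurable_fun setT X.
Proof. by rewrite inE => /andP[]; rewrite inE. Qed.

Lemma L2_integrable_mul X Y : L2 X -> L2 Y ->
  P.-integrable setT (EFin \o (fun w => X w * Y w)).
Proof. by move=> lX lY; apply/Lfun1_integrable/Lfun2_mul_Lfun1. Qed.

Lemma L2_scale (c : R) X : L2 X -> L2 (fun w => c * X w).
Proof.
move=> lX; rewrite (_ : (fun w => c * X w) = (fun w => X w * c)); first last.
  by apply/funext => w; rewrite mulrC.
by apply: (@Lfun_scale _ _ _ P X c 2) => //; rewrite ler1n.
Qed.

Lemma L2_sub X Y : L2 X -> L2 Y -> L2 (fun w => X w - Y w).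
Proof.
move=> lX lY; have [_ H] := @Lfun_addr_closed _ _ _ P 2%:E (lee1n 2).
have := H _ _ lX (L2_scale (-1) lY).
have -> // : X + (fun w => -1 * Y w) = (fun w => X w - Y w).
by apply/funext => w; transitivity (X w + -1 * Y w); rewrite // mulN1r.
Qed.

Lemma ipC X Y : ip X Y = ip Y X.
Proof. by apply: eq_Rintegral => w _; rewrite mulrC. Qed.

Lemma ipBl X Y Z : L2 X -> L2 Y -> L2 Z ->
  ip (fun w => X w - Y w) Z = ip X Z - ip Y Z.
Proof.
move=> lX lY lZ; rewrite /ip -RintegralB//; try exact: L2_integrable_mul.
by apply: eq_Rintegral => w _; rewrite mulrBl.
Qed.

Lemma ipZl (c : R) X Y : L2 X -> L2 Y -> ip (fun w => c * X w) Y = c * ip X Y.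
Proof.
move=> lX lY; rewrite /ip -RintegralZl//; last exact: L2_integrable_mul.
by apply: eq_Rintegral => w _; rewrite mulrA.
Qed.

Lemma ipBr X Y Z : L2 X -> L2 Y -> L2 Z ->
  ip Z (fun w => X w - Y w) = ip Z X - ip Z Y.
Proof. by move=> *; rewrite ipC ipBl// !(ipC Z). Qed.

Lemma ipZr (c : R) X Y : L2 X -> L2 Y -> ip Y (fun w => c * X w) = c * ip Y X.
Proof. by move=> *; rewrite ipC ipZl// ipC. Qed.

Lemma ip_ge0 X : 0 <= ip X X.
Proof. by apply: Rintegral_ge0 => w _; rewrite -expr2 sqr_ge0. Qed.

Lemma expectation_mul X Y : L2 X -> L2 Y ->
  ('E_P[fun w => (X w * Y w)%R] = (ip X Y)%:E)%E.
Proof.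
move=> lX lY; rewrite unlock /ip /Rintegral fineK//.
exact/integrable_fin_num/L2_integrable_mul.
Qed.

Lemma cauchy_schwarz X Y : L2 X -> L2 Y -> ip X Y ^+ 2 <= ip X X * ip Y Y.
Proof.
move=> lX lY.
have H (t : R) : 0 <= ip X X - 2 * t * ip X Y + t ^+ 2 * ip Y Y.
  have := ip_ge0 (fun w => X w - t * Y w).
  have ltY := L2_scale t lY.
  rewrite ipBl ?ipBr ?ipZl ?ipZr ?L2_sub// (ipC Y X).
  by have -> : ip X X - t * ip X Y - (t * ip X Y - t * (t * ip Y Y)) =
    ip X X - 2 * t * ip X Y + t ^+ 2 * ip Y Y by ring.
have := ip_ge0 Y; rewrite le_eqVlt => /predU1P[Y0|Y0].
  rewrite -Y0 mulr0.
  have [->|xy0] := eqVneq (ip X Y) 0; first by rewrite expr0n.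
  (* With [ip Y Y] = 0 the quadratic is affine in t; this t would give it the value -1. *)
  have := H ((ip X X + 1) / (2 * ip X Y)); rewrite -Y0 mulr0 addr0.
  have -> : 2 * ((ip X X + 1) / (2 * ip X Y)) * ip X Y = ip X X + 1 by field.
  lra.
have := H (ip X Y / ip Y Y).
have -> : ip X X - 2 * (ip X Y / ip Y Y) * ip X Y + (ip X Y / ip Y Y) ^+ 2 * ip Y Y
   = (ip X X * ip Y Y - ip X Y ^+ 2) / ip Y Y by field; rewrite gt_eqF.
by rewrite pmulr_lge0 ?invr_gt0// subr_ge0.
Qed.

(** Equivalent to the nonnegativity of the square of X + Y, written X - (-1) * Y so that the rules
    for differences and multiples apply. *)
Lemma ip_sub_le X Y : L2 X -> L2 Y ->
  ip (fun w => X w - Y w) (fun w => X w - Y w) <= 2 * ip X X + 2 * ip Y Y.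
Proof.
move=> lX lY; have lmY := L2_scale (-1) lY.
have := ip_ge0 (fun w => X w - (-1) * Y w).
rewrite !ipBl ?ipBr ?ipZl ?ipZr ?L2_sub// (ipC Y X); lra.
Qed.

Lemma ip_le_sqrt X Y : L2 X -> L2 Y ->
  `|ip X Y| <= Num.sqrt (ip X X) * Num.sqrt (ip Y Y).
Proof.
move=> lX lY; rewrite -sqrtrM ?ip_ge0// -sqrtr_sqr ler_wsqrtr//.
exact: cauchy_schwarz.
Qed.

Lemma L2_of_sqr_integral X (e : R) : measurable_fun setT X ->
  (\int[P]_w ((X w) ^+ 2)%:E <= e%:E)%E -> L2 X /\ ip X X <= e.
Proof.
move=> mX Xe; have lX : L2 X.
  rewrite inE; apply/andP; split; rewrite inE//= /finite_norm unlock /Lnorm poweR_lty//.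
  apply: le_lt_trans (ltry e); apply: le_trans Xe.
  rewrite le_eqVlt; apply/orP; left; apply/eqP; apply: eq_integral => w _.
  by rewrite /= powR_mulrn// real_normK// num_real.
split => //; rewrite -lee_fin; apply: le_trans Xe.
rewrite /ip /Rintegral fineK; last exact/integrable_fin_num/L2_integrable_mul.
by under eq_integral => w _ do rewrite -expr2.
Qed.

(** Cauchy-Schwarz against the constant 1, whose square has integral 1 for a probability. *)
Lemma abs_integral_le_ip X : L2 X ->
  (\int[P]_w `|X w|%:E <= (Num.sqrt (ip X X))%:E)%E.
Proof.
move=> lX.
have l1 : L2 (cst 1 : T -> R) by exact: Lfun_cst.
have laX : L2 (fun w => `|X w|).
  have mX := L2_measurable lX.
  apply: (L2_of_sqr_integral (e := ip X X) _ _).1; first exact: measurableT_comp.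
  rewrite /ip /Rintegral fineK; last exact/integrable_fin_num/L2_integrable_mul.
  rewrite le_eqVlt; apply/orP; left; apply/eqP; apply: eq_integral => w _.
  by rewrite /= real_normK ?num_real// expr2.
have := ip_le_sqrt laX l1.
have -> : ip (cst 1) (cst 1) = 1.
  rewrite /ip; under eq_Rintegral do rewrite /= mulr1.
  by rewrite Rintegral_cst// mul1r; rewrite [X in fine X]probability_setT.
have -> : ip (fun w => `|X w|) (fun w => `|X w|) = ip X X.
  by apply: eq_Rintegral => w _; rewrite /= -expr2 real_normK ?num_real// expr2.
rewrite sqrtr1 mulr1 => H.
apply: le_trans (_ : (ip (fun w => `|X w|) (cst 1))%:E <= _)%E; last first.
  by rewrite lee_fin (le_trans (ler_norm _) H).
rewrite /ip /Rintegral fineK; last exact/integrable_fin_num/L2_integrable_mul.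
by under [leRHS]eq_integral => w _ do rewrite /= mulr1.
Qed.

(** The increments have L^1 norms at most 2 ^ (- n), so the sum of their absolute values is
    integrable, hence finite almost everywhere, and the telescoping series converges absolutely
    there. *)
Lemma ae_cvg_of_fast_cauchy (X : nat -> T -> R) : (forall n, L2 (X n)) ->
  (forall n, ip (fun w => X n.+1 w - X n w) (fun w => X n.+1 w - X n w) <= 4^-1 ^+ n) ->
  {ae P, forall w, cvgn (X ^~ w)}.
Proof.
move=> lX HX.
pose D n w := (`|X n.+1 w - X n w|%:E)%E.
have lD n : L2 (fun w => X n.+1 w - X n w) by exact: L2_sub.
have mD n : measurable_fun setT (D n).
  by apply/measurable_EFinP; apply: measurableT_comp => //; exact: L2_measurable.
have D0 n w : setT w -> (0 <= D n w)%E by rewrite lee_fin.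
have iD n : (\int[P]_w D n w <= (2 / (2 ^ (n + 1))%:R)%:E)%E.
  apply: le_trans (abs_integral_le_ip (lD n)) _; rewrite lee_fin.
  have -> : 2 / (2 ^ (n + 1))%:R = Num.sqrt (4^-1 ^+ n) :> R.
    have -> : 4^-1 = 2^-1 ^+ 2 :> R by field.
    rewrite -exprM mulnC exprM sqrtr_sqr ger0_norm ?exprn_ge0// addn1 expnS natrM natrX.
    by rewrite exprVn; field; rewrite expf_neq0.
  exact: ler_wsqrtr.
have iS : (\int[P]_w (\sum_(n <oo) D n w) < +oo)%E.
  rewrite integral_nneseries//.
  apply: (@le_lt_trans _ _ (\sum_(n <oo) (2 / (2 ^ (n + 1))%:R)%:E)%E).
    apply: lee_nneseries => n _; last exact: iD.
    by move=> _; apply: integral_ge0 => w; exact: D0.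
  by rewrite (cvg_lim _ (@cvg_geometric_eseries_half R 2 0))// ltry.
have intS : P.-integrable setT (fun w => (\sum_(n <oo) D n w)%E).
  apply/integrableP; split.
    by apply: ge0_emeasurable_sum => *; [exact: D0 | exact: mD].
  rewrite (eq_integral (fun w => (\sum_(n <oo) D n w)%E)) ?iS// => w _.
  by rewrite gee0_abs// nneseries_ge0// => n _ _; exact: D0.
have := integrable_ae measurableT intS.
apply: filterS => w /(_ I) Sfin.
have cD : cvgn (series (fun n => X n.+1 w - X n w)).
  apply: normed_cvg; apply: nondecreasing_is_cvgn.
    by apply: nondecreasing_series => *; exact: normr_ge0.
  exists (fine (\sum_(n <oo) D n w)%E) => _ [n _ <-].
  rewrite -lee_fin fineK//.
  have := @nneseries_lim_ge R (D ^~ w) xpredT 0 n (fun n _ _ => D0 n w I).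
  by rewrite /series/= -sumEFin.
have E : X ^~ w = (fun n => X 0 w + series (fun n => X n.+1 w - X n w) n).
  apply/funext => n; rewrite /series/= telescope_sumr// addrC subrK//.
by rewrite E; apply: is_cvgD => //; exact: is_cvg_cst.
Qed.

Lemma limn_einf_le (u : nat -> \bar R) (e : \bar R) :
  (forall n, (u n <= e)%E) -> (limn_einf u <= e)%E.
Proof.
move=> ue; rewrite limn_einf_lim; apply: lime_le; first exact: is_cvg_einfs.
apply: nearW => n; apply: le_trans (ue n); apply: ereal_inf_lbound.
by exists n => //=.
Qed.

Lemma limn_einf_ge0 (u : nat -> \bar R) :
  (forall n, (0 <= u n)%E) -> (0 <= limn_einf u)%E.
Proof.
move=> u0; rewrite limn_einf_lim; apply: lime_ge; first exact: is_cvg_einfs.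
by apply: nearW => n; apply: le_ereal_inf_tmp => _ [m _ <-].
Qed.

(** Riesz-Fischer for a fast Cauchy sequence: the limit exists almost everywhere, and Fatou's lemma
    carries the bounds over to it. *)
Lemma L2_complete (X : nat -> T -> R) : (forall n, L2 (X n)) ->
  (forall n m, (n <= m)%N ->
    ip (fun w => X n w - X m w) (fun w => X n w - X m w) <= 4^-1 ^+ n) ->
  exists Y, L2 Y /\ forall n, ip (fun w => X n w - Y w) (fun w => X n w - Y w) <= 4^-1 ^+ n.
Proof.
move=> lX HX.
have cv : {ae P, forall w, cvgn (X ^~ w)}.
  apply: ae_cvg_of_fast_cauchy => // n; apply: le_trans (HX n n.+1 (leqnSn n)).
  rewrite le_eqVlt; apply/orP; left; apply/eqP; apply: eq_Rintegral => w _.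
  by rewrite -mulrNN !opprB.
(* An upper limit is measurable on the whole space; off the set of convergence its value is
   irrelevant. *)
pose Y w := fine (limn_esup (fun n => (X n w)%:E)).
have mX n : measurable_fun setT (X n) by exact: L2_measurable.
have mY : measurable_fun setT Y.
  apply: (measurableT_comp (@fine_measurable _ setT measurableT)) => //.
  by apply: measurable_fun_limn_esup => n; apply/measurable_EFinP.
have YE w : cvgn (X ^~ w) -> X ^~ w @ \oo --> Y w.
  move=> cw; have cE : (X n w)%:E @[n --> \oo] --> (limn (X ^~ w))%:E.
    by apply: cvg_EFin => //; exact: nearW.
  rewrite /Y is_cvg_limn_esupE; last by apply/cvg_ex; eexists; exact: cE.
  by rewrite (cvg_lim _ cE).
have key n : L2 (fun w => X n w - Y w) /\
    ip (fun w => X n w - Y w) (fun w => X n w - Y w) <= 4^-1 ^+ n.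
  apply: L2_of_sqr_integral; first exact: measurable_funB.
  pose f m w := (((X n w - X (n + m)%N w) ^+ 2)%:E)%E.
  have mf m : measurable_fun setT (f m).
    by apply/measurable_EFinP; apply: measurable_funX; exact: measurable_funB.
  have f0 m w : setT w -> (0 <= f m w)%E by rewrite lee_fin sqr_ge0.
  (* Wherever X converges, (X n - Y) ^ 2 is the lower limit in m of (X n - X (n + m)) ^ 2. *)
  rewrite (@ge0_ae_eq_integral _ _ _ P setT _ (fun w => limn_einf (f ^~ w)))//.
  - apply: le_trans (fatou P measurableT mf f0) _; apply: limn_einf_le => m.
    have lXX := L2_sub (lX n) (lX (n + m)%N).
    rewrite [X in (X <= _)%E](_ : _ = (ip (fun w => X n w - X (n + m)%N w)
       (fun w => X n w - X (n + m)%N w))%:E); first by rewrite lee_fin HX ?leq_addr.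
    rewrite /ip /Rintegral fineK; last exact/integrable_fin_num/L2_integrable_mul.
    by apply: eq_integral => w _; rewrite /f expr2.
  - by apply/measurable_EFinP; apply: measurable_funX; exact: measurable_funB.
  - rewrite (_ : (fun w => _) = (fun w => (- limn_esup (fun m => - f m w))%E)).
      apply: measurableT_comp => //; apply: measurable_fun_limn_esup => m.
      exact: measurableT_comp.
    apply/funext => w; rewrite -limn_einfN; congr limn_einf.
    by apply/funext => m; exact: (esym (oppeK _)).
  - by move=> w _; rewrite lee_fin sqr_ge0.
  - by move=> w _; apply: limn_einf_ge0 => m; exact: f0.
  - apply: filterS cv => w cw _; apply/esym.
    have H : X (n + m)%N w @[m --> \oo] --> Y w.
      by have := YE w cw; rewrite -(cvg_shiftn n); under eq_fun do rewrite addnC.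
    have cf : f m w @[m --> \oo] --> ((X n w - Y w) ^+ 2)%:E.
      apply: cvg_EFin; first exact: nearW.
      have H2 : X n w - X (n + m)%N w @[m --> \oo] --> X n w - Y w.
        by apply: cvgB; [exact: cvg_cst | exact: H].
      by rewrite expr2; apply: cvgM.
    rewrite is_cvg_limn_einfE; first exact: cvg_lim.
    by apply/cvg_ex; eexists; exact: cf.
exists Y; split; last by move=> n; case: (key n).
have -> : Y = (fun w => X 0 w - (X 0 w - Y w)).
  by apply/funext => w; rewrite subKr.
by apply: L2_sub; [exact: lX | case: (key 0)].
Qed.

End square_integrable.
(** * Positivity of the Gamma function *)

(** For an integer n >= max(y, 1), 1 + t <= n * exp(t / n), hence (1 + t) ^ y <= (1 + t) ^ n <= n ^
    n * exp t. *)
Lemma powR_mul_expRN_le (R : realType) (y : R) : 0 <= y ->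
  exists K, forall t : R, 0 <= t -> (1 + t) `^ y * expR (- t) <= K.
Proof.
move=> y0; have [n0 /(_ n0.+1 (leqnSn _))] := natr_ge_ex y.
move: n0.+1 (ltn0Sn n0) => n n_gt0 yn.
have n1 : 1 <= n%:R :> R by rewrite ler1n.
have nn0 : n%:R != 0 :> R by rewrite pnatr_eq0 -lt0n.
exists (n%:R ^+ n) => t t0.
have H : 1 + t <= n%:R * expR (t / n%:R).
  apply: (@le_trans _ _ (n%:R * (1 + t / n%:R))); last by rewrite ler_wpM2l// expR_ge1Dx.
  have -> : n%:R * (1 + t / n%:R) = n%:R + t :> R by field.
  by rewrite lerD2r.
rewrite expRN ler_pdivrMr ?expR_gt0//.
apply: (@le_trans _ _ ((1 + t) ^+ n)).
  by rewrite -powR_mulrn ?addr_ge0// ler_powR//; lra.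
have -> : expR t = expR (t / n%:R) ^+ n.
  by rewrite -expRM_natl; congr expR; field.
by rewrite -exprMn lerXn2r ?nnegrE ?mulr_ge0 ?expR_ge0 ?addr_ge0.
Qed.

Lemma continuous_within_of_derive (R : realType) (f df : R -> R) (a b : R) :
  (forall t, a <= t <= b -> is_derive t 1 f (df t)) -> {within `[a, b], continuous f}.
Proof.
move=> fd; apply: derivable_within_continuous => x; rewrite in_itv/= => xab.
by have [] := fd x xab.
Qed.

Lemma FTC2_of_derive (R : realType) (F f : R -> R) (a b : R) : a < b ->
  (forall t, a <= t <= b -> is_derive t 1 F (f t)) -> {within `[a, b], continuous f} ->
  (\int[lebesgue_measure]_(t in `[a, b]) (f t)%:E = (F b - F a)%:E)%E.
Proof.
move=> ab Fd cf; rewrite (continuous_FTC2 (F := F))//.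
  have /(continuous_within_itvP _ ab)[_ Fa Fb] := continuous_within_of_derive Fd.
  split => // x; rewrite in_itv/= => /andP[ax xb].
  by have [] := Fd x; rewrite ?(ltW ax) ?(ltW xb).
move=> x; rewrite in_itv/= => /andP[ax xb]; rewrite derive1E.
have xI : a <= x <= b by rewrite !ltW.
exact: (@derive_val _ _ _ _ _ _ _ (Fd x xI)).
Qed.

Section Gamma_positive.
Context {R : realType}.
Variable x : R.
Hypothesis x0 : 0 < x.
Local Notation mu := (@lebesgue_measure R).
Let f (t : R) := t `^ (x - 1) * expR (- t).
Let g (t : R) := t `^ (x - 1) * (1 + t) `^ (- (x + 1)).
(* [G] is an antiderivative of [g], which dominates [f] up to a constant. *)
Let G (t : R) := t `^ x * (1 + t) `^ (- x) / x.

Let f_ge0 (t : R) : 0 <= f t.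
Proof. by rewrite mulr_ge0 ?powR_ge0 ?expR_ge0. Qed.

Let measurable_f : measurable_fun setT f.
Proof.
apply: measurable_funM; first exact: measurable_powR.
by apply: measurableT_comp => //; exact: oppr_measurable.
Qed.

Let derive_G (t : R) : 0 < t -> is_derive t 1 G (g t).
Proof.
move=> t0; have t1 : 0 < t + 1 by lra.
have H1 := is_derive1_powR x t0.
have H2 := @is_derive_comp _ (fun u : R => u `^ (- x)) (fun u : R => u + 1) t _ _
  (is_derive1_powR (- x) t1) (is_derive_addr t 1).
have := is_derive_scale x^-1 (is_derive_mul H1 H2).
rewrite (_ : (fun u => _) = G); last by apply/funext => u; rewrite /G addrC mulrC (addrC 1).
move/trigger_derive; apply; rewrite /g -opprD -(addrC 1 t) mulr1.
have E1 : t `^ x = t `^ (x - 1) * t by rewrite -powR_subr1.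
have E2 : (1 + t) `^ (- x) = (1 + t) `^ (- x - 1) * (1 + t) by rewrite -powR_subr1// addrC.
rewrite E1 E2 opprD; field; exact: lt0r_neq0.
Qed.

(** G t is (t / (1 + t)) ^ x / x. *)
Let G_le (t : R) : 0 < t -> 0 <= G t <= x^-1.
Proof.
move=> t0; apply/andP; split; first by rewrite !mulr_ge0 ?powR_ge0 ?invr_ge0 ?(ltW x0).
rewrite /G ler_piMl ?invr_ge0 ?(ltW x0)// powRN ler_pdivrMr ?powR_gt0 ?addr_gt0// mul1r.
by rewrite ge0_ler_powR ?nnegrE ?(ltW x0) ?(ltW t0)//; lra.
Qed.

Let continuous_g (a b : R) : 0 < a -> {within `[a, b], continuous g}.
Proof.
move=> a0; apply: (@continuous_within_of_derive _ _ (derive1 g)) => t /andP[at_ _].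
have t0 : 0 < t by exact: lt_le_trans at_.
have t1 : 0 < t + 1 by lra.
rewrite derive1E; apply/derivableP.
have H1 := is_derive1_powR (x - 1) t0.
have H2 := @is_derive_comp _ (fun u : R => u `^ (- (x + 1))) (fun u : R => u + 1) t _ _
  (is_derive1_powR (- (x + 1)) t1) (is_derive_addr t 1).
have [H _] := is_derive_mul H1 H2.
rewrite (_ : g = (fun u : R => u `^ (x - 1) * (u + 1) `^ (- (x + 1)))); first exact: H.
by apply/funext => u; rewrite /g [1 + u]addrC.
Qed.

(** [Gamma] is a real-valued integral, equal to 0 by convention if the integral is infinite;
    positivity therefore rests on finiteness. *)
Lemma Gamma_integral_lty :
  (\int[lebesgue_measure]_(t in `]0%R, +oo[) (t `^ (x - 1) * expR (- t))%:E < +oo)%E.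
Proof.
have [|K HK] := @powR_mul_expRN_le _ (x + 1); first by rewrite addr_ge0 ?(ltW x0).
have K0 : 0 <= K by apply: le_trans (HK 0 (lexx _)); rewrite mulr_ge0 ?powR_ge0 ?expR_ge0.
(* On these intervals, away from 0, [g] is continuous and the fundamental theorem of calculus
   applies; they exhaust the half-line. *)
pose A n : set R := [set` `[n.+1%:R^-1, n.+1%:R]].
have AU : \bigcup_n A n = `]0, +oo[%classic.
  apply/seteqP; split => t /=.
    by move=> [n _]; rewrite /A/= !in_itv/= => /andP[nt _]; rewrite (lt_le_trans _ nt)// invr_gt0.
  rewrite in_itv/= andbT => t0; pose n := (Num.bound (t + t^-1)).
  have tn : t + t^-1 < n.+1%:R.
    apply: lt_le_trans (archi_boundP _) _; last by rewrite ler_nat.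
    by rewrite addr_ge0 ?invr_ge0 ?(ltW t0).
  have ti : 0 < t^-1 by rewrite invr_gt0.
  exists n => //; rewrite /A/= in_itv/=; apply/andP; split; last lra.
  by rewrite -[leRHS]invrK lef_pV2 ?posrE ?ltr0n//; lra.
have ndA : nondecreasing_seq A.
  move=> m n mn; apply/subsetPset => t; rewrite /A/= !in_itv/= => /andP[mt tm].
  apply/andP; split; last by rewrite (le_trans tm)// ler_nat.
  by rewrite (le_trans _ mt)// lef_pV2 ?posrE ?ltr0n// ler_nat.
have mA n : measurable (A n) by exact: measurable_itv.
have := @ge0_nondecreasing_set_cvg_integral _ (measurableTypeR R) R A (EFin \o f)
  lebesgue_measure ndA mA.
rewrite AU => H.
have {}H : (\int[mu]_(t in A n) (f t)%:E @[n --> \oo] --> \int[mu]_(t in `]0%R, +oo[) (f t)%:E)%E.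
  apply: H => [n|n t _]; last by rewrite lee_fin.
  by apply/measurable_EFinP; apply: measurable_funTS.
apply: le_lt_trans (ltry (K * x^-1)).
rewrite -(cvg_lim _ H)//; apply: lime_le; first by apply/cvg_ex; eexists; exact: H.
apply: nearW => n; rewrite EFinM.
have n0 : 0 < n.+1%:R^-1 :> R by rewrite invr_gt0.
have mg : measurable_fun setT g.
  apply: measurable_funM; first exact: measurable_powR.
  apply: (measurableT_comp (measurable_powR _)).
  by apply: measurable_funD => //.
apply: (@le_trans _ _ (\int[mu]_(t in A n) (K%:E * (g t)%:E))%E).
  apply: ge0_le_integral; first exact: mA.
  - by move=> t _; rewrite lee_fin.
  - by apply/measurable_EFinP; apply: measurable_funTS.
  - by apply/measurable_EFinP; apply: measurable_funTS; exact: measurable_funM.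
  move=> t; rewrite /A/= in_itv/= => /andP[nt _]; rewrite lee_fin /f /g.
  have t0 : 0 < t by exact: lt_le_trans nt.
  rewrite mulrCA ler_wpM2l ?powR_ge0// powRN ler_pdivlMr ?powR_gt0 ?addr_gt0//.
  by rewrite mulrC HK// ltW.
rewrite ge0_integralZl//; last 3 first.
- exact: measurable_itv.
- by apply/measurable_EFinP; exact: measurable_funTS.
- by move=> t _; rewrite lee_fin mulr_ge0 ?powR_ge0.
rewrite lee_wpmul2l ?lee_fin//.
(* For n = 0 the interval is reduced to the point 1. *)
have [->|n_gt0] := eqVneq n 0.
  by rewrite /A invr1 set_itv1 integral_set1 lee_fin invr_ge0 ltW.
have n1 : n.+1%:R^-1 < n.+1%:R :> R.
  have : 1 < n.+1%:R :> R by rewrite ltr1n ltnS lt0n.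
  by move=> h; rewrite (lt_trans _ h)// invf_lt1// (lt_trans ltr01 h).
rewrite (@FTC2_of_derive _ G g _ _ n1 _ (@continuous_g _ _ n0)).
  rewrite lee_fin.
  have [_ H1] := andP (G_le (ltr0Sn R n)); have [H2 _] := andP (G_le n0); lra.
by move=> t /andP[nt _]; apply: derive_G; exact: lt_le_trans nt.
Qed.

Lemma Gamma_gt0 : 0 < Gamma x.
Proof.
rewrite /Gamma /Rintegral fine_gt0// Gamma_integral_lty andbT.
(* A lower bound of the integrand on [1, 2], whatever the sign of x - 1. *)
pose c := Num.min 1 (2 `^ (x - 1)) * expR (- 2).
have c0 : 0 < c by rewrite mulr_gt0 ?expR_gt0// lt_min ltr01 powR_gt0.
apply: (@lt_le_trans _ _ (\int[mu]_(t in `[1%R, 2%R]) c%:E)%E).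
  rewrite integral_cst//= lebesgue_measure_itv/= lte_fin ltr1n/=.
  by rewrite -EFinB -EFinM lte_fin mulr_gt0//; lra.
apply: (@le_trans _ _ (\int[mu]_(t in `[1%R, 2%R]) (f t)%:E)%E); last first.
  apply: ge0_subset_integral; [exact: measurable_itv|exact: measurable_itv| | |].
  - by apply/measurable_EFinP; exact: measurable_funTS.
  - by move=> t _; rewrite lee_fin.
  - by move=> t /=; rewrite !in_itv/= andbT => /andP[t1 _]; rewrite (lt_le_trans _ t1).
apply: ge0_le_integral; first exact: measurable_itv.
- by move=> t _; rewrite lee_fin ltW.
- exact: measurable_cst.
- by apply/measurable_EFinP; exact: measurable_funTS.
move=> t; rewrite /= in_itv/= => /andP[t1 t2]; rewrite lee_fin /c ler_pM ?expR_ge0//.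
- rewrite ge_min; have [x1|/ltW x1] := leP 0 (x - 1).
    by rewrite -[X in X <= _](one_powR (x - 1)) ge0_ler_powR ?nnegrE//; lra.
  by rewrite (le0_ger_powR x1 _ t2) ?orbT//; lra.
- by rewrite ler_expR lerN2.
Qed.

End Gamma_positive.
(** * Mean-square derivatives *)

(** Two applications of the mean value theorem, to y |-> f (y - t) - f y and then to f1, turn the
    quotient into - f2 at a point of norm at most |s| + |t| < rho. *)
Lemma second_difference (R : realType) (f f1 f2 : R -> R) (rho eps : R) :
  (forall t : R, `|t| < rho -> is_derive t 1 f (f1 t)) ->
  (forall t : R, `|t| < rho -> is_derive t 1 f1 (f2 t)) ->
  (forall t : R, `|t| < rho -> `|f2 t - f2 0| <= eps) ->
  forall s t : R, s != 0 -> t != 0 -> `|s| < rho / 2 -> `|t| < rho / 2 ->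
  `|(f (s - t) - f s - f (- t) + f 0) / (s * t) + f2 0| <= eps.
Proof.
move=> fd f1d f2c s t s0 t0 sr tr.
have n0 : `|0 : R| <= `|s| by rewrite normr0.
have [y ys|c cs] := @mean_value_ball _ (fun y => f (y - t) - f y)
    (fun y => f1 (y - t) - f1 y) `|s| 0 s n0 (lexx _).
  have y1 : `|y - t| < rho by rewrite (le_lt_trans (ler_normB _ _))//; lra.
  have y2 : `|y| < rho by have := normr_ge0 s; lra.
  have H := @is_derive_comp _ f (fun y : R => y - t) y _ _ (fd _ y1) (is_derive_addr y (- t)).
  by have := is_derive_sub H (fd _ y2); rewrite mulr1.
rewrite sub0r subr0 => E1.
have ct : `|c - t| <= `|s| + `|t| by rewrite (le_trans (ler_normB _ _))// lerD2r.
have [|y ys|c' c's] := @mean_value_ball _ f1 f2 (`|s| + `|t|) c (c - t) _ ct.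
- by rewrite (le_trans cs)// lerDl.
- by apply: f1d; lra.
have -> : c - t - c = - t by ring.
move=> E2.
have -> : (f (s - t) - f s - f (- t) + f 0) / (s * t) = - f2 c'.
  have -> : f (s - t) - f s - f (- t) + f 0 = f2 c' * - t * s.
    by rewrite -E2 -E1; ring.
  by field; rewrite s0 t0.
by rewrite addrC distrC f2c//; lra.
Qed.

Section mean_square.
Context {R : realType} {d : nat}.
Context {disp : measure_display} {T : measurableType disp}.
Variable P : probability T R.
Local Notation V := 'rV[R]_d.
Local Notation L2 X := ((X : T -> R) \in Lfun P 2%:E).

Definition diffq (Z : V -> {RV P >-> R}) (v : V) (h : R) (x : V) : T -> R :=
  fun w => h^-1 * (Z (x + h *: v) w - Z x w).

Lemma L2_diffq (Z : V -> {RV P >-> R}) v h x : (forall x, L2 (Z x)) -> L2 (diffq Z v h x).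
Proof. by move=> lZ; apply/L2_scale/L2_sub; exact: lZ. Qed.

Variables (w x1 : R).
Hypotheses (w0 : 0 < w) (x1_gt0 : 0 < x1).
Local Notation q := (quad w).

Lemma quad_line_open (h v : V) : q h < x1 ->
  exists rho, 0 < rho /\ forall t : R, `|t| < rho -> q (h + t *: v) < x1.
Proof.
move=> qh; have e0 : 0 < (x1 - q h) / 2 by lra.
have [rho [rho0 H]] := line_derive_continuous (line_derive_quad w h v) e0.
exists rho; split => // t /H; rewrite ler_norml => /andP[_]; lra.
Qed.

(** Uncentred, so that inner products suffice, and restricted to close points, since the expansion
    of the covariance holds only near the origin. *)
Definition second_moment (Z : V -> {RV P >-> R}) (F : V -> R) :=
  forall x y, q (x - y) < x1 -> ip P (Z x) (Z y) = F (x - y).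

Variables (F F1 F2 : V -> R) (v : V) (Z : V -> {RV P >-> R}).
Hypothesis HF1 : forall h, q h < x1 -> line_derive F h v (F1 h).
Hypothesis HF2 : forall h, q h < x1 -> line_derive F1 h v (F2 h).
Hypothesis HF2c : forall h eps, q h < x1 -> 0 < eps ->
  exists t1, 0 < t1 /\ forall t : R, `|t| < t1 -> `|F2 (h + t *: v) - F2 h| <= eps.
Hypothesis lZ : forall x, L2 (Z x).
Hypothesis ZF : second_moment Z F.

(** Bilinearity yields a second difference of F at xi. As delta depends on x - y only, one sequence
    of steps will serve all the points x. *)
Lemma ip_diffq_limit (xi : V) (eps : R) : q xi < x1 -> 0 < eps ->
  exists delta, 0 < delta /\ forall x y : V, x - y = xi ->
    forall s t : R, s != 0 -> t != 0 -> `|s| < delta -> `|t| < delta ->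
    `|ip P (diffq Z v s x) (diffq Z v t y) + F2 xi| <= eps.
Proof.
move=> qxi e0.
have [r1 [r1_gt0 H1]] := quad_line_open v qxi.
have [r2 [r2_gt0 H2]] := HF2c qxi e0.
pose rho := Num.min r1 r2.
have rho0 : 0 < rho by rewrite lt_min r1_gt0.
have rr (t : R) : `|t| < rho -> `|t| < r1 /\ `|t| < r2.
  by rewrite lt_min => /andP[].
exists (rho / 2); split; first by rewrite divr_gt0.
move=> x y xy s t s0 t0 sr tr.
pose f (u : R) := F (xi + u *: v).
have srho : `|s| < rho by lra.
have trho : `|t| < rho by lra.
have strho : `|s - t| < rho by rewrite (le_lt_trans (ler_normB _ _))//; lra.
have := @second_difference _ f (fun u => F1 (xi + u *: v)) (fun u => F2 (xi + u *: v))
  rho eps _ _ _ s t s0 t0 sr tr.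
rewrite scale0r addr0 => H.
have {}H := H _ _ _.
have -> : ip P (diffq Z v s x) (diffq Z v t y) =
   (f (s - t) - f s - f (- t) + f 0) / (s * t).
  have lx := lZ x; have ly := lZ y; have lxs := lZ (x + s *: v); have lyt := lZ (y + t *: v).
  have E1 : x + s *: v - (y + t *: v) = xi + (s - t) *: v.
    by rewrite -xy scalerBl opprD addrACA.
  have E2 : x + s *: v - y = xi + s *: v by rewrite -xy addrAC.
  have E3 : x - (y + t *: v) = xi + (- t) *: v by rewrite -xy opprD addrA scaleNr.
  have E4 : x - y = xi + 0 *: v by rewrite xy scale0r addr0.
  have Q1 : q (x + s *: v - (y + t *: v)) < x1 by rewrite E1; apply: H1; exact: (rr _ strho).1.
  have Q2 : q (x + s *: v - y) < x1 by rewrite E2; apply: H1; exact: (rr _ srho).1.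
  have Q3 : q (x - (y + t *: v)) < x1.
    by rewrite E3; apply: H1; rewrite normrN; exact: (rr _ trho).1.
  have Q4 : q (x - y) < x1 by rewrite xy.
  rewrite /diffq ipZl ?ipZr ?L2_scale ?L2_sub// ipBl ?L2_sub// !ipBr// !ZF//.
  by rewrite E1 E2 E3 E4 /f; field; rewrite s0 t0.
apply: H => u ur; have [ur1 ur2] := rr u ur.
- by apply: line_derive_shift; apply: HF1; exact: H1.
- by apply: line_derive_shift; apply: HF2; exact: H1.
- exact: H2.
Qed.

Local Notation sq X := (ip P X X).

Lemma diffq_cauchy (eps : R) : 0 < eps -> exists delta, 0 < delta /\
  forall x (s t : R), s != 0 -> t != 0 -> `|s| < delta -> `|t| < delta ->
    sq (fun w => diffq Z v s x w - diffq Z v t x w) <= eps.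
Proof.
(* The square expands into four inner products, all close to - F2 0, which cancels out. *)
move=> e0; have e40 : 0 < eps / 4 by lra.
have q0 : q (0 : V) < x1 by rewrite quad0.
have [delta [d0 H]] := ip_diffq_limit q0 e40.
exists delta; split => // x s t s0 t0 sd td.
have lD h := L2_diffq v h x lZ.
rewrite ipBl ?ipBr ?L2_sub// (ipC P (diffq Z v t x) (diffq Z v s x)).
have := H x x (subrr x) s s s0 s0 sd sd.
have := H x x (subrr x) t t t0 t0 td td.
have := H x x (subrr x) s t s0 t0 sd td.
move: (F2 0) (ip _ _ _) (ip _ _ _) (ip _ _ _) => A B C D.
rewrite !ler_norml => /andP[? ?] /andP[? ?] /andP[? ?]; lra.
Qed.

Lemma diffq_limit : exists Y : V -> {RV P >-> R}, (forall x, L2 (Y x)) /\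
  forall eps, 0 < eps -> exists delta, 0 < delta /\
    forall x (h : R), h != 0 -> `|h| < delta ->
      sq (fun w => diffq Z v h x w - Y x w) <= eps.
Proof.
have H4 n : 0 < 4^-1 ^+ n :> R by rewrite exprn_gt0// invr_gt0.
have [del Hdel] := choice (fun n => diffq_cauchy (H4 n)).
(* Steps that decrease and stay below [del n], so that any later step is also admissible at rank
   n. *)
pose s := fix s n := if n is m.+1 then Num.min (s m) (del m.+1 / 2) else del 0 / 2.
have del_gt0 n : 0 < del n by case: (Hdel n).
have s_gt0 n : 0 < s n.
  by elim: n => [|n IH] /=; rewrite ?lt_min ?IH/= divr_gt0.
have s_del n : s n < del n.
  have [dn _] := Hdel n.
  by case: n dn => [|n] dn /=; rewrite ?gt_min; [|apply/orP; right]; lra.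
have s_mono n m : (n <= m)%N -> s m <= s n.
  elim: m => [|m IH]; first by rewrite leqn0 => /eqP ->.
  rewrite leq_eqVlt => /predU1P[->//|]; rewrite ltnS => /IH.
  by apply: le_trans; rewrite /= ge_min lexx.
have sE n : `|s n| = s n by rewrite gtr0_norm.
have ex x : exists Y, L2 Y /\ forall n,
    sq (fun w => diffq Z v (s n) x w - Y w) <= 4^-1 ^+ n.
  apply: (@L2_complete _ _ _ P (fun n => diffq Z v (s n) x)) => [n|n m nm].
    exact: L2_diffq.
  have [_ H] := Hdel n; apply: H; rewrite ?gt_eqF ?sE//.
  by rewrite (le_lt_trans (s_mono n m nm)).
have [Y HY] := choice ex.
have mY x : Y x \in mfun by rewrite inE; apply: L2_measurable (HY x).1.
exists (fun x => mfun_Sub (mY x)); split; first by move=> x; exact: (HY x).1.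
move=> eps e0.
(* An arbitrary h is compared with the limit through the step [s n]; [ip_sub_le] doubles each of the
   two errors 4 ^ (- n). *)
have [n Hn] : exists n, 4 * 4^-1 ^+ n <= eps.
  have [n0 /(_ n0 (leqnn _)) Hn0] := natr_ge_ex (4 / eps).
  exists n0; rewrite exprVn ler_pdivrMr ?exprn_gt0// -ler_pdivrMl// mulrC.
  apply: le_trans Hn0 _; rewrite -natrX ler_nat.
  by apply: ltnW; apply: ltn_expl.
have [dn Hdn] := Hdel n.
exists (del n); split => // x h h0 hd.
have lD t := L2_diffq v t x lZ; have [lY HYx] := HY x.
have E : (fun w => diffq Z v h x w - mfun_Sub (mY x) w) =
   (fun w => (diffq Z v h x w - diffq Z v (s n) x w) - (Y x w - diffq Z v (s n) x w)).
  by apply/funext => u /=; ring.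
rewrite E; apply: le_trans (ip_sub_le (L2_sub (lD h) (lD (s n))) (L2_sub lY (lD (s n)))) _.
have H1 := Hdn x h (s n) h0.
have {}H1 : sq (fun w => diffq Z v h x w - diffq Z v (s n) x w) <= 4^-1 ^+ n.
  by apply: H1; rewrite ?gt_eqF ?sE.
have H2 : sq (fun w => Y x w - diffq Z v (s n) x w) <= 4^-1 ^+ n.
  apply: le_trans (HYx n); rewrite le_eqVlt; apply/orP; left; apply/eqP.
  by apply: eq_Rintegral => u _; ring.
lra.
Qed.

Lemma second_moment_limit (Y : V -> {RV P >-> R}) : (forall x, L2 (Y x)) ->
  (forall eps, 0 < eps -> exists delta, 0 < delta /\
    forall x (h : R), h != 0 -> `|h| < delta ->
      sq (fun w => diffq Z v h x w - Y x w) <= eps) ->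
  second_moment Y (fun h => - F2 h).
Proof.
move=> lY HY x y qxy.
(* The factor of eps in the total error: 1 for the limit of the quotients, 1 for the product of the
   two errors (as eps <= 1), and the norms of Y x and Y y for the cross terms. *)
pose C := 2 + Num.sqrt (sq (Y x)) + Num.sqrt (sq (Y y)).
have C0 : 0 < C by rewrite /C -addrA ltr_pwDl// addr_ge0 ?sqrtr_ge0.
suff key eps : 0 < eps -> eps <= 1 -> `|ip P (Y x) (Y y) + F2 (x - y)| <= eps * C.
  apply/eqP; rewrite -subr_eq0 opprK -normr_le0 leNgt; apply/negP => H.
  pose z := `|ip P (Y x) (Y y) + F2 (x - y)|; rewrite -/z in H.
  pose eps := Num.min 1 (z / (2 * C)).
  have zC : 0 < z / (2 * C) by rewrite divr_gt0// mulr_gt0.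
  have := key eps; rewrite -/z lt_min ltr01 zC ge_min lexx => /(_ isT isT).
  have : eps * C <= z / 2.
    rewrite -ler_pdivlMr// ge_min; apply/orP; right.
    by rewrite invfM mulrA.
  lra.
move=> e0 e1; have ee0 : 0 < eps ^+ 2 by rewrite exprn_gt0.
have [d1 [d1_gt0 H1]] := HY _ ee0.
have [d2 [d2_gt0 H2]] := ip_diffq_limit qxy e0.
pose h := Num.min d1 d2 / 2.
have m0 : 0 < Num.min d1 d2 by rewrite lt_min d1_gt0.
have h_gt0 : 0 < h by rewrite divr_gt0.
have hm : h < Num.min d1 d2 by rewrite /h; lra.
have h0 : h != 0 by rewrite gt_eqF.
have hE : `|h| = h by rewrite gtr0_norm.
have [h1 h2] : `|h| < d1 /\ `|h| < d2 by move: hm; rewrite lt_min hE => /andP[].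
have := H2 x y erefl h h h0 h0 h2 h2.
have := H1 x h h0 h1; have := H1 y h h0 h1.
have lDx := L2_diffq v h x lZ; have lDy := L2_diffq v h y lZ.
set A := diffq Z v h x in lDx *; set B := diffq Z v h y in lDy *.
pose a u := A u - Y x u; pose b u := B u - Y y u.
have la : L2 a by exact: L2_sub.
have lb : L2 b by exact: L2_sub.
rewrite -/a -/b => Hb Ha HAB.
have sqrt_le (X : T -> R) : sq X <= eps ^+ 2 -> Num.sqrt (sq X) <= eps.
  by move=> H; rewrite -[leRHS]ger0_norm ?(ltW e0)// -sqrtr_sqr ler_wsqrtr.
have E : ip P A B = ip P a b + ip P a (Y y) + ip P (Y x) b + ip P (Y x) (Y y).
  by rewrite /a /b !ipBl ?ipBr ?L2_sub//; ring.
have B1 := ip_le_sqrt la lb; have B2 := ip_le_sqrt la (lY y); have B3 := ip_le_sqrt (lY x) lb.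
have a_le := sqrt_le a Ha; have b_le := sqrt_le b Hb.
have {}B1 : `|ip P a b| <= eps.
  apply: le_trans B1 _; rewrite -[leRHS]mulr1 ler_pM ?sqrtr_ge0//.
  exact: le_trans e1.
have {}B2 : `|ip P a (Y y)| <= eps * Num.sqrt (sq (Y y)).
  by apply: le_trans B2 _; rewrite ler_wpM2r ?sqrtr_ge0.
have {}B3 : `|ip P (Y x) b| <= eps * Num.sqrt (sq (Y x)).
  by apply: le_trans B3 _; rewrite mulrC ler_wpM2r ?sqrtr_ge0.
have -> : ip P (Y x) (Y y) + F2 (x - y) =
   (ip P A B + F2 (x - y)) - (ip P a b + ip P a (Y y) + ip P (Y x) b) by rewrite E; ring.
rewrite (le_trans (ler_normB _ _))//.
apply: (@le_trans _ _ (eps + (eps + eps * Num.sqrt (sq (Y y)) + eps * Num.sqrt (sq (Y x))))).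
  rewrite lerD// (le_trans (ler_normD _ _))// lerD// (le_trans (ler_normD _ _))// lerD//.
by rewrite /C; lra.
Qed.

Lemma ms_derivative_of_limit (Y : V -> {RV P >-> R}) : (forall x, L2 (Y x)) ->
  (forall eps, 0 < eps -> exists delta, 0 < delta /\
    forall x (h : R), h != 0 -> `|h| < delta ->
      sq (fun w => diffq Z v h x w - Y x w) <= eps) ->
  ms_derivative Z v Y.
Proof.
move=> lY HY x.
rewrite (_ : (fun h : R => _) = (fun h : R => (sq (fun w => diffq Z v h x w - Y x w))%:E)).
  apply: cvg_EFin; first exact: nearW.
  apply/cvgrPdist_le => eps e0; have [delta [d0 H]] := HY eps e0.
  rewrite near_withinE.
  have : \forall h \near (0 : R), `|h| < delta by apply: near_norm_lt; rewrite normr0.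
  apply: filterS => h hd h0 /=.
  by rewrite sub0r normrN ger0_norm ?ip_ge0// H.
apply/funext => h; have lD := L2_diffq v h x lZ.
rewrite -expectation_mul ?L2_sub//; congr expectation; apply/funext => u.
by rewrite /diffq expr2 [h^-1 * _]mulrC.
Qed.

End mean_square.

(** Each mean-square derivative costs two derivatives of the second moment, whence [m.*2]. *)
Lemma smooth_ms_differentiable (R : realType) (d : nat) (disp : measure_display)
    (T : measurableType disp) (P : probability T R) (w : R) (phi : nat -> R -> R)
    (k : nat) (e C x1 : R) :
  0 < w -> 0 < x1 -> 0 <= C -> k%:R < 2 * e -> derivative_chain x1 phi ->
  (forall i (x : R), (i <= k)%N -> 0 < x < x1 -> `|phi i x| <= C * x `^ (e - i%:R)) ->
  (forall i, phi i 0 = 0) ->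
  forall (m : nat) (F : 'rV[R]_d -> R) (Z : 'rV[R]_d -> {RV P >-> R}),
  smooth w phi k m.*2 F -> (forall x, (Z x : T -> R) \in Lfun P 2%:E) ->
  second_moment w x1 Z F -> ms_differentiable m Z.
Proof.
move=> w0 x1_gt0 C0 ke ch bd phi0; elim=> // m IH F Z sF lZ ZF v.
have [F1 [sF1 dF1]] := smooth_derive w0 x1_gt0 C0 ke ch bd phi0 sF v.
have [F2 [sF2 dF2]] := smooth_derive w0 x1_gt0 C0 ke ch bd phi0 sF1 v.
have cF2 h eps : quad w h < x1 -> 0 < eps ->
    exists t1, 0 < t1 /\ forall t : R, `|t| < t1 -> `|F2 (h + t *: v) - F2 h| <= eps.
  exact: (smooth_continuous w0 x1_gt0 C0 ke ch bd phi0 sF2).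
have [Y [lY HY]] := diffq_limit x1_gt0 dF1 dF2 cF2 lZ ZF.
exists Y; split; first exact: (ms_derivative_of_limit lZ lY HY).
have ZY := second_moment_limit dF1 dF2 cF2 lZ ZF lY HY.
exact: IH (smooth_opp sF2) lY ZY.
Qed.

(** * Polynomial parts, boundary values and the order of the singularity *)

Lemma mono_horner (R : realType) (d : nat) (w : R) (Q : {poly R}) :
  mono 0 (fun h : 'rV[R]_d => Q.[quad w h]).
Proof.
elim/poly_ind: Q => [|Q c IH].
  rewrite (_ : (fun h => _) = (fun=> 0)); first exact: mono_const.
  by apply/funext => h; rewrite horner0.
rewrite (_ : (fun h => _) = (fun h => Q.[quad w h] * quad w h + c)).
  apply: mono_add; last exact: mono_const.
  exact: mono_weaken (leq0n _) (mono_mul IH (mono_quad w)).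
by apply/funext => h; rewrite hornerMXaddC.
Qed.

Lemma horner_bound (R : realType) (Q : {poly R}) :
  exists B, 0 <= B /\ forall x : R, 0 <= x <= 1 -> `|Q.[x]| <= B.
Proof.
exists (\sum_(i < size Q) `|Q`_i|); split; first exact: sumr_ge0.
move=> x /andP[x0 x1]; rewrite horner_coef (le_trans (ler_norm_sum _ _ _))//.
apply: ler_sum => i _; rewrite normrM ler_piMr//.
by rewrite ger0_norm ?exprn_ge0// exprn_ile1.
Qed.

Lemma even_odd_poly (R : realType) (T : {poly R}) :
  exists E D : {poly R}, forall r : R, T.[r] = E.[r ^+ 2] + r * D.[r ^+ 2].
Proof.
elim/poly_ind: T => [|T c [E [D H]]].
  by exists 0, 0 => r; rewrite !horner0; ring.
exists (D * 'X + c%:P), E => r.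
by rewrite !hornerMXaddC H; ring.
Qed.

(** A converse of Abel's theorem, elementary for nonnegative coefficients: a partial sum at 1 is the
    limit of the partial sums at 1 - x, each at most [psum c (1 - x)], hence at most L. *)
Lemma psum_at1 (R : realType) (c : nat -> R) (L : R) :
  (forall n, 0 <= c n) -> subunit c ->
  psum c (1 - x) @[x --> 0^'+] --> L -> psum c 1 = L.
Proof.
move=> c0 sc cL.
have near01 : \forall x \near (0 : R)^'+, 0 < x < 1.
  near=> x; apply/andP; split; near: x; first exact: nbhs_right_gt.
  exact: nbhs_right_lt.
have leL n : series (fun i => c i * 1 ^+ i) n <= L.
  have E (z : R) : (\poly_(i < n) c i).[z] = series (fun i => c i * z ^+ i) n.
    by rewrite horner_poly /series/= big_mkord.
  have cS : (\poly_(i < n) c i).[1 - x] @[x --> 0^'+] --> (\poly_(i < n) c i).[1].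
    apply: cvg_at_right_filter.
    have H : (1 - x) @[x --> (0 : R)] --> (1 : R).
      by rewrite -[X in _ --> X]subr0; apply: cvgB; [exact: cvg_cst | exact: cvg_id].
    apply: (cvg_comp _ _ H); exact: continuous_horner.
  rewrite -E; apply: ler_cvg_to cS cL _.
  apply: filterS near01 => x /andP[x0 x1]; rewrite E.
  have xI : 0 <= 1 - x < 1 by apply/andP; split; lra.
  apply: nondecreasing_cvgn_le; last exact: subunit_cvg.
  apply/nondecreasing_seqP => m; rewrite /pseries /series/= big_nat_recr//= lerDl.
  by rewrite mulr_ge0 ?exprn_ge0//; lra.
have nd : nondecreasing_seq (pseries c 1).
  apply/nondecreasing_seqP => m; rewrite /pseries /series/= big_nat_recr//= lerDl.
  by rewrite mulr_ge0 ?exprn_ge0.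
have cv : cvgn (pseries c 1).
  by apply: nondecreasing_is_cvgn => //; exists L => _ [n _ <-]; exact: leL.
apply/eqP; rewrite eq_le; apply/andP; split.
  by apply: limr_le => //; apply: nearW => n; exact: leL.
apply: (ler_cvg_to cL (cvg_cst (psum c 1))).
apply: filterS near01 => x /andP[x0 x1].
have xI : 0 <= 1 - x < 1 by apply/andP; split; lra.
apply: lim_series_le => // [|n]; first exact: subunit_cvg.
rewrite ler_wpM2l// expr1n exprn_ile1//; lra.
Unshelve. all: by end_near. Qed.

Section asymptotic_lower_bound.
Context {R : realType}.
Variables (f : nat -> R -> R) (N : nat) (nu c x1 : R).
Hypotheses (c0 : 0 < c) (x1_gt0 : 0 < x1) (nu0 : 0 < nu) (Nnu : nu < N%:R).
Hypothesis f_chain : derivative_chain x1 f.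
Hypothesis f_lower : forall x, 0 < x < x1 -> c * x `^ (nu - N%:R) <= f N x.

Lemma not_small_of_derivative_lower_bound :
  ~ (forall eps, 0 < eps -> exists x2, 0 < x2 /\
       forall x, 0 < x < x2 -> `|f 0 x| <= eps * x `^ nu).
Proof.
move: (x1_gt0) (Nnu) => x1_gt0' Nnu' H.
(* The nodes x, 2 x, ..., (N + 1) x of the N-th difference lie in [x, M x]. Below, A and B are the
   constants of the two estimates, and eps = A / (2 B) makes them incompatible. *)
pose M : R := N%:R + 1.
have M0 : 0 < M by rewrite ltr_wpDl.
have M1 : 1 <= M by rewrite lerDr.
pose A := c * M `^ (nu - N%:R); pose B := 2 ^+ N * M `^ nu.
have A0 : 0 < A by rewrite mulr_gt0 ?powR_gt0.
have B0 : 0 < B by rewrite mulr_gt0 ?powR_gt0 ?exprn_gt0.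
have e0 : 0 < A / (2 * B) by rewrite divr_gt0// mulr_gt0.
have [x2 [x2_gt0 Hx2]] := H _ e0.
pose y := Num.min x1 x2; have y0 : 0 < y by rewrite lt_min x1_gt0.
pose x := y / (2 * M).
have x_gt0 : 0 < x by rewrite divr_gt0 ?mulr_gt0.
have Mx : M * x = y / 2 by rewrite /x; field; rewrite gt_eqF.
clearbody x.
have xNx : x + N%:R * x = M * x by rewrite /M; ring.
have Mx0 : 0 < M * x by rewrite mulr_gt0.
have [y1 y2] : y <= x1 /\ y <= x2 by rewrite /y !ge_min !lexx orbT.
have I z : x <= z <= x + N%:R * x -> [/\ 0 < z, z < x1, z < x2 & z <= M * x].
  by rewrite xNx Mx => /andP[? ?]; split; lra.
have lo := @fdiff_ge _ N f x x (c * (M * x) `^ (nu - N%:R)) x1 f_chain x_gt0 x_gt0.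
have {}lo : c * (M * x) `^ (nu - N%:R) * x `^ N%:R <= iter N (fdiff x) (f 0) x.
  rewrite powR_mulrn ?(ltW x_gt0)//; apply: lo; first by rewrite xNx Mx; lra.
  move=> z /I[z0 zx1 _ zM].
  apply: le_trans (_ : c * z `^ (nu - N%:R) <= _); last by apply: f_lower; rewrite z0.
  by rewrite ler_wpM2l ?(ltW c0)// le0_ger_powR// subr_le0 ltW.
have up := @fdiff_le _ N (f 0) x x (A / (2 * B) * (M * x) `^ nu) (ltW x_gt0).
have {}up : `|iter N (fdiff x) (f 0) x| <= 2 ^+ N * (A / (2 * B) * (M * x) `^ nu).
  apply: up => z /I[z0 _ zx2 zM].
  apply: le_trans (Hx2 z _) _; first by rewrite z0.
  by rewrite ler_wpM2l ?(ltW e0)// ge0_ler_powR ?nnegrE ?(ltW nu0) ?(ltW z0) ?(ltW Mx0).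
have := le_trans lo (le_trans (ler_norm _) up).
rewrite !powRM ?(ltW M0) ?(ltW x_gt0)//.
have -> : c * (M `^ (nu - N%:R) * x `^ (nu - N%:R)) * x `^ N%:R = A * x `^ nu.
  rewrite -!mulrA -powRD ?subrK ?(gt_eqF x_gt0) ?implybT//.
have -> : 2 ^+ N * (A / (2 * B) * (M `^ nu * x `^ nu)) = A / 2 * x `^ nu.
  have AB : A / (2 * B) * B = A / 2.
    by move: (A) (B) B0 => a b b0; field; exact: lt0r_neq0.
  by rewrite -AB; move: (A / (2 * B)) => z; rewrite /B; ring.
by rewrite ler_pM2r ?powR_gt0//; lra.
Qed.

End asymptotic_lower_bound.

Lemma derivative_chain_shrink (R : realType) (x0 x1 : R) (psi : nat -> R -> R) :
  x1 <= x0 -> derivative_chain x0 psi -> derivative_chain x1 psi.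
Proof.
by move=> x10 ch i x /andP[x_gt0 xx1]; apply: ch; rewrite x_gt0 (lt_le_trans xx1).
Qed.

Lemma hyppsi_expansion (R : realType) (p q s : R) (k : nat) :
  0 < p -> 0 < q -> 0 < s -> k%:R < 2 * (s - p - q) ->
  exists (Q : {poly R}) (phi : nat -> R -> R) (e C x1 : R),
  [/\ [/\ 0 < x1, x1 <= 1, 0 <= C & k%:R < 2 * e], derivative_chain x1 phi,
     forall i (x : R), (i <= k)%N -> 0 < x < x1 -> `|phi i x| <= C * x `^ (e - i%:R),
     forall i, phi i 0 = 0 &
     forall x, 0 <= x < x1 -> hyppsi p q s 0 x = Q.[x] + phi 0 x].
Proof.
move=> p0 q0 s0 knu; pose nu := s - p - q.
(* No integer lies strictly between [k / 2] and [(k + 1) / 2]. *)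
pose e := (k%:R / 2 + Num.min nu ((k%:R + 1) / 2)) / 2.
have [ke ek enu] : [/\ k%:R < 2 * e, 2 * e < k%:R + 1 & e < nu].
  rewrite /e -/nu in knu *; have [H|H] := leP nu ((k%:R + 1) / 2); split; lra.
have eN (n : nat) : e != n%:R.
  apply/eqP => en; move: ke ek; rewrite en -natrM natr1 !ltr_nat; lia.
have e0 : 0 < e by have : 0 <= k%:R :> R by []; lra.
have [N0 HN0] := natr_ge_ex (nu + 1).
(* N exceeds nu, for the estimate of the N-th derivative, and is at least k, so that the orders up
   to k are covered on the way down. *)
pose N := maxn N0 k.
have Nnu : 0 < N%:R - (s - p - q).
  by have := HN0 N (leq_maxl _ _); rewrite /nu; lra.
have [C1 HC1] := hyppsi_upper p0 q0 s0 Nnu.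
have ch1 := hyppsi_chain p0 q0 s0.
have h12 : 0 < (1 / 2 : R) by lra.
have ch : derivative_chain (1 / 2) (hyppsi p q s).
  by apply: derivative_chain_shrink ch1; lra.
have bd x : 0 < x < 1 / 2 -> `|hyppsi p q s N x| <= `|C1| * x `^ (e - N%:R).
  move=> xI; apply: le_trans (HC1 x xI) _; have /andP[x0 x1] := xI.
  apply: (@le_trans _ _ (`|C1| * x `^ (- (N%:R - (s - p - q))))).
    by rewrite ler_wpM2r ?powR_ge0 ?ler_norm.
  rewrite ler_wpM2l// ger_powR//; first by rewrite x0/=; lra.
  by rewrite opprB lerD2r ltW.
have [Q [x1 [C [/andP[x1_gt0 x1h] HQ]]]] := integrate_down h12 eN ch bd.
(* The cut at 0 enforces the convention phi i 0 = 0. *)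
pose phi i (x : R) := if 0 < x then hyppsi p q s i x - (Q^`(i)).[x] else 0.
have phi0 i : phi i 0 = 0 by rewrite /phi ltxx.
exists Q, phi, e, `|C|, x1; split => //.
- by split => //; lra.
- move=> i x xI; have /andP[x0 xx1] := xI.
  have H1 : is_derive x 1 (hyppsi p q s i) (hyppsi p q s i.+1 x).
    by apply: ch; rewrite x0 (lt_le_trans xx1).
  have H2 := is_derive_sub H1 (is_derive_poly (Q^`(i)) x).
  rewrite /phi x0 derivnS; apply: near_eq_is_derive H2.
  near=> y; have -> // : 0 < y by near: y; exact: lt_nbhsr.
- move=> i x ik xI; have /andP[x0 _] := xI; rewrite /phi x0.
  apply: le_trans (HQ i x _ xI) _; first by rewrite (leq_trans ik)// leq_maxr.
  by rewrite ler_wpM2r ?powR_ge0 ?ler_norm.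
move=> x /andP[]; rewrite le_eqVlt => /predU1P[<- _|x0 xx1]; last first.
  by rewrite /phi x0 derivn0 subrKC.
(* At x = 0 the claim is that the Gauss series summed at 1 equals Q.[0]. *)
clear x; rewrite phi0 addr0 /hyppsi subr0 one_powR expr0 !mul1r hypd0.
apply: psum_at1 => [n||]; first exact/ltW/hypc_gt0.
  exact: subunit_hypc.
have cE : hyppsi p q s 0 x - Q.[x] @[x --> 0^'+] --> 0.
  apply/cvgrPdist_le => eps eps0.
  have [|t1 [t1_gt0 Ht1]] := @powR_small _ e (eps / (`|C| + 1)) e0.
    by rewrite divr_gt0// ltr_wpDl.
  near=> x; have x0 : 0 < x by near: x; exact: nbhs_right_gt.
  have xx1 : x < x1 by near: x; exact: nbhs_right_lt.
  have xt1 : x < t1 by near: x; exact: nbhs_right_lt.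
  rewrite sub0r normrN; have := HQ 0 x (leq0n _); rewrite x0 xx1 => /(_ isT).
  rewrite derivn0 mulr0n subr0 => /le_trans; apply.
  have := Ht1 x; rewrite (ltW x0) xt1 => /(_ isT).
  rewrite ler_pdivlMr ?ltr_wpDl// mulrDr mulr1.
  have : C * x `^ e <= `|C| * x `^ e by rewrite ler_wpM2r ?powR_ge0 ?ler_norm.
  have := powR_ge0 x e; rewrite [`|C| * _]mulrC; lra.
have cQ : Q.[x] @[x --> 0^'+] --> Q.[0].
  by apply: cvg_at_right_filter; exact: continuous_horner.
have cP : (1 - x) `^ (1 - s) @[x --> 0^'+] --> (1 : R).
  have p1 : 0 < 1 - 0 :> R by rewrite subr0.
  have [H _] := @is_derive_comp _ (fun u : R => u `^ (1 - s)) (fun u : R => 1 - u) 0 _ _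
    (is_derive1_powR (1 - s) p1) (is_derive_subl 1 0).
  have Hc : {for 0, continuous (fun u : R => (1 - u) `^ (1 - s))}.
    exact/differentiable_continuous/derivable1_diffP.
  have H' : (1 - x) `^ (1 - s) @[x --> (0 : R)^'+] --> (1 - 0 : R) `^ (1 - s).
    by apply: cvg_at_right_filter; exact: Hc.
  by move: H'; rewrite subr0 one_powR.
(* The factor (1 - x) ^ (1 - s) tends to 1 and cancels the power in [hyppsi], leaving the series
   alone. *)
have H : (hyppsi p q s 0 x - Q.[x] + Q.[x]) * (1 - x) `^ (1 - s) @[x --> 0^'+] --> Q.[0].
  have -> : Q.[0] = (0 + Q.[0]) * 1 by rewrite add0r mulr1.
  by apply: cvgM; [apply: cvgD; [exact: cE | exact: cQ] | exact: cP].
apply: cvg_trans H; apply: near_eq_cvg; near=> x.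
have x0 : 0 < x by near: x; exact: nbhs_right_gt.
have x_lt1 : x < 1 by near: x; exact: nbhs_right_lt.
rewrite /= subrK /hyppsi expr0 mul1r mulr0n subr0 hypd0 mulrAC -powRD.
  by rewrite [X in _ `^ X](_ : _ = 0) ?powRr0 ?mul1r//; ring.
by rewrite subr_eq0 (gt_eqF x_lt1) implybT.
Unshelve. all: by end_near. Qed.

(** * The Gauss hypergeometric covariance *)

Section gauss_covariance.
Context {R : realType}.
Variables (d : nat) (a alpha beta gamma : R).
Hypotheses (a0 : 0 < a) (hP : in_Pd d alpha beta gamma).
Local Notation p := (beta - alpha).
Local Notation q := (gamma - alpha).
Local Notation s := (beta - alpha + gamma - d%:R / 2).
Local Notation g := (gauss_cov d a alpha beta gamma).
Local Notation psi := (hyppsi p q s).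

Definition gauss_const : R :=
  Gamma (beta - d%:R / 2) * Gamma (gamma - d%:R / 2)
    / (Gamma (beta - alpha + gamma - d%:R / 2) * Gamma (alpha - d%:R / 2)).

(** p q >= alpha / 2 > 0 gives p and q the same sign, and p + q >= alpha + 1 / 2 makes it
    positive. *)
Lemma in_Pd_gt0 : [/\ 0 < p, 0 < q, 0 < alpha - d%:R / 2 & 0 < s].
Proof.
have [[al be ga] dal H1 H2] := hP.
have pq : 0 < p * q by lra.
have p0 : 0 < p.
  rewrite ltNge; apply/negP => p_le0; have q0 : 0 < q by lra.
  by have := mulr_le0_ge0 p_le0 (ltW q0); rewrite leNgt pq.
have q0 : 0 < q by rewrite -(pmulr_rgt0 _ p0).
by split => //; lra.
Qed.

Lemma gauss_const_gt0 : 0 < gauss_const.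
Proof.
have [[al be ga] dal _ _] := hP; have [p0 q0 n0 s0] := in_Pd_gt0.
by rewrite divr_gt0// mulr_gt0// Gamma_gt0//; lra.
Qed.

Lemma gauss_covE (r : R) : r ^+ 2 / a ^+ 2 < 1 ->
  g r = gauss_const * psi 0 (r ^+ 2 / a ^+ 2).
Proof.
move=> r1; rewrite /gauss_cov; have -> : Num.max (1 - r ^+ 2 / a ^+ 2) 0 = 1 - r ^+ 2 / a ^+ 2.
  by apply/max_idPl; rewrite subr_ge0 ltW.
by rewrite /hyppsi expr0 mul1r mulr0n subr0 hypd0 mulrA.
Qed.

Lemma gauss_times_derivable_lt (k : nat) : times_derivable k.+1 g 0 ->
  (k.+1 + d)%:R / 2 < alpha.
Proof.
move=> gk; have [p0 q0 n0 s0] := in_Pd_gt0; have c0 := gauss_const_gt0.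
have a_gt0 := a0; set nu := alpha - d%:R / 2 in n0.
have nuE : s - p - q = nu by rewrite /nu; ring.
rewrite ltNge; apply/negP => Hk.
have kn : nu <= k.+1%:R / 2 by move: Hk; rewrite natrD /nu; lra.
have [N /(_ N (leqnn _)) HN] := natr_ge_ex (nu + 1).
have t0 : 0 < N%:R - (s - p - q) by rewrite nuE; lra.
have [c [x1 [c_gt0 /andP[x1_gt0 x1_lt1] lower]]] := hyppsi_lower p0 q0 s0 t0.
rewrite nuE opprB in lower t0.
have [T HT] := poly_approx_of_times_derivable gk.
have [E [D TE]] := even_odd_poly T.
(* The even part of the Taylor polynomial in the variable x, where r ^ 2 = a ^ 2 * x. *)
pose E2 := E \Po (a ^+ 2 *: 'X).
have [B [B0 HB]] := horner_bound (E2^`(N)).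
(* The error of approximation, with the sign that makes its N-th derivative positive near 0. *)
pose f i (x : R) := (-1) ^+ N * (gauss_const * psi i x - (E2^`(i)).[x]).
pose c1 := gauss_const * c.
have c1_gt0 : 0 < c1 by rewrite mulr_gt0.
(* Below t1, the bound B on the N-th derivative of the polynomial is at most half of the main term
   c1 * x ^ (nu - N). *)
have e0 : 0 < c1 / (2 * (B + 1)) by rewrite divr_gt0// mulr_gt0//; lra.
have [t1 [t1_gt0 Ht1]] := powR_small t0 e0.
pose x3 := Num.min x1 t1.
have x3_gt0 : 0 < x3 by rewrite lt_min x1_gt0.
have fch : derivative_chain x3 f.
  move=> i x /andP[x0]; rewrite lt_min => /andP[xx1 xt1].
  have H1 : is_derive x 1 (psi i) (psi i.+1 x).
    by apply: (hyppsi_chain p0 q0 s0); rewrite x0 (lt_trans xx1).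
  have H2 := is_derive_poly (E2^`(i)) x.
  have := is_derive_scale ((-1) ^+ N) (is_derive_sub (is_derive_scale gauss_const H1) H2).
  by rewrite /f derivnS.
have fN x : 0 < x < x3 -> c1 / 2 * x `^ (nu - N%:R) <= f N x.
  move=> /andP[x0]; rewrite lt_min => /andP[xx1 xt1].
  have := lower x; rewrite x0 xx1 => /(_ isT) low.
  have {}low : c1 * x `^ (nu - N%:R) <= gauss_const * ((-1) ^+ N * psi N x).
    by rewrite /c1 -mulrA ler_wpM2l// ltW.
  have BE : `|(-1) ^+ N * (E2^`(N)).[x]| <= B.
    rewrite normrM normrX normrN1 expr1n mul1r HB// (ltW x0)/=; lra.
  have BX : B <= c1 / 2 * x `^ (nu - N%:R).
    rewrite -[nu - _]opprB powRN ler_pdivlMr ?powR_gt0//.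
    have := Ht1 x; rewrite (ltW x0) xt1 => /(_ isT).
    rewrite ler_pdivlMr ?mulr_gt0//; last lra.
    have := powR_ge0 x (N%:R - nu); lra.
  rewrite /f mulrBr mulrCA.
  by move: BE; rewrite ler_norml => /andP[_]; lra.
apply: (@not_small_of_derivative_lower_bound _ f N nu (c1 / 2) x3) => //.
- by rewrite divr_gt0.
- lra.
move=> eps eps0.
have ak0 : 0 < a ^+ k.+1 by rewrite exprn_gt0.
have ea0 : 0 < eps / a ^+ k.+1 by rewrite divr_gt0.
have /nbhs_ballP[del /= del0 Hdel] := HT _ ea0.
pose x2 := Num.min x3 ((del / a) ^+ 2).
have da0 : 0 < del / a by rewrite divr_gt0.
exists x2; split; first by rewrite lt_min x3_gt0 exprn_gt0.
move=> x /andP[x0]; rewrite !lt_min => /andP[/andP[xx1 xt1] xd].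
pose r := a * Num.sqrt x.
have sx0 : 0 < Num.sqrt x by rewrite sqrtr_gt0.
have r0 : 0 < r by rewrite mulr_gt0.
have r2 : r ^+ 2 = a ^+ 2 * x by rewrite exprMn sqr_sqrtr// ltW.
have rd : r < del.
  rewrite /r mulrC -ltr_pdivlMr// -[ltRHS]ger0_norm ?(ltW da0)// -sqrtr_sqr.
  by rewrite ltr_sqrt// exprn_gt0.
have ra : r ^+ 2 / a ^+ 2 = x.
  by rewrite r2 mulrAC mulfV ?mul1r// expf_neq0// gt_eqF.
have gr : g r = gauss_const * psi 0 x.
  by rewrite gauss_covE ra// (lt_trans xx1).
have gN : g (- r) = g r by rewrite /gauss_cov sqrrN.
have H1 : `|g r - T.[r]| <= eps / a ^+ k.+1 * r ^+ k.+1.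
  have := Hdel r; rewrite -ball_normE/= sub0r normrN gtr0_norm// => /(_ rd).
  by [].
have H2 : `|g r - T.[- r]| <= eps / a ^+ k.+1 * r ^+ k.+1.
  have := Hdel (- r); rewrite -ball_normE/= sub0r opprK gtr0_norm// => /(_ rd).
  by rewrite gN normrN (gtr0_norm r0).
have E2x : E2.[x] = E.[r ^+ 2] by rewrite horner_comp hornerZ hornerX r2.
rewrite /f normrM normrX normrN1 expr1n mul1r derivn0 E2x -gr.
(* Averaging over r and - r removes the odd part of T. *)
have -> : g r - E.[r ^+ 2] = ((g r - T.[r]) + (g r - T.[- r])) / 2.
  by rewrite !TE sqrrN; field.
(* r ^ (k + 1) = a ^ (k + 1) * x ^ ((k + 1) / 2), with x < 1 and nu <= (k + 1) / 2. *)
have r_le : eps / a ^+ k.+1 * r ^+ k.+1 <= eps * x `^ nu.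
  rewrite exprMn mulrA divfK ?(gt_eqF ak0)// ler_wpM2l ?(ltW eps0)//.
  rewrite -powR12_sqrt ?(ltW x0)// -powR_mulrn ?powR_ge0// -powRrM.
  rewrite ger_powR ?x0 ?(ltW (lt_trans xx1 _))//; lra.
rewrite normrM [`|2^-1|]ger0_norm ?invr_ge0// ler_pdivrMr//.
rewrite (le_trans (ler_normD _ _))//; lra.
Qed.

(** The shift b is 0 for the radial function, and the square of the mean of the field when passing
    from its covariance to its second moment. *)
Lemma gauss_local_expansion (k : nat) : (k + d)%:R / 2 < alpha ->
  exists (phi : nat -> R -> R) (e C x1 : R) (F : R -> 'rV[R]_d -> R),
  [/\ [/\ 0 < x1, 0 <= C & k%:R < 2 * e], derivative_chain x1 phi,
     (forall i (x : R), (i <= k)%N -> 0 < x < x1 -> `|phi i x| <= C * x `^ (e - i%:R)),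
     (forall i, phi i 0 = 0) &
     (forall b, smooth (a ^+ 2)^-1 phi k k (F b)) /\
     forall b r (h : 'rV[R]_d), r ^+ 2 = dot h h -> quad (a ^+ 2)^-1 h < x1 ->
       g r + b = F b h].
Proof.
move=> kal; have [p0 q0 n0 s0] := in_Pd_gt0.
have knu : k%:R < 2 * (s - p - q) by move: kal; rewrite natrD; lra.
have [Q [phi [e [C [x1 [[x1_gt0 x1_le1 C0 ke] ch bd phi0 HQ]]]]]] :=
  hyppsi_expansion p0 q0 s0 knu.
exists phi, e, C, x1, (fun b h => (gauss_const * Q.[quad (a ^+ 2)^-1 h] + b)
   + gauss_const * phi 0 (quad (a ^+ 2)^-1 h)).
split => //; split => [b|b r h rh qh].
  apply: smooth_add.
    apply: (@smooth_mono _ _ _ _ _ k 0); apply: mono_add; last exact: mono_const.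
    exact: (mono_mul (mono_const _) (mono_horner d _ Q)).
  have kk : (k + 0.*2 <= 0 + k)%N by rewrite add0n addn0.
  exact: (@smooth_term R d (a ^+ 2)^-1 phi k k 0 0 (fun=> gauss_const)
    (mono_const gauss_const) (leqnn k) kk).
have qE : r ^+ 2 / a ^+ 2 = quad (a ^+ 2)^-1 h by rewrite rh mulrC.
have w0 : 0 < (a ^+ 2)^-1 by rewrite invr_gt0 exprn_gt0.
rewrite gauss_covE; last by rewrite qE (lt_le_trans qh).
by rewrite qE HQ ?qh ?quad_ge0//; ring.
Qed.

Lemma gauss_times_derivable (k : nat) : (1 <= d)%N -> (k + d)%:R / 2 < alpha ->
  times_derivable k g 0.
Proof.
move=> hd /gauss_local_expansion[phi [e [C [x1 [F [[x1_gt0 C0 ke] ch bd phi0 [sF HF]]]]]]].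
have w0 : 0 < (a ^+ 2)^-1 by rewrite invr_gt0 exprn_gt0.
pose v : 'rV[R]_d := delta_mx ord0 (Ordinal hd).
have vv : dot v v = 1.
  rewrite /dot (bigD1 (Ordinal hd))//= mxE !eqxx mul1r big1 ?addr0// => j ji.
  by rewrite mxE (negbTE ji) andbF mul0r.
have qv (r : R) : `|r| < a * Num.sqrt x1 -> quad (a ^+ 2)^-1 (r *: v) < x1.
  move=> rr; rewrite quadZ /quad vv mulr1 ltr_pdivrMr ?exprn_gt0//.
  rewrite -real_normK ?num_real// (_ : x1 * a ^+ 2 = (a * Num.sqrt x1) ^+ 2).
    by rewrite ltrXn2r// ?nnegrE// mulr_ge0 ?sqrtr_ge0 ?(ltW a0).
  by rewrite exprMn sqr_sqrtr ?(ltW x1_gt0)// mulrC.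
apply: (smooth_times_derivable w0 x1_gt0 C0 ke ch bd phi0 (sF 0) qv).
  move=> r rr; rewrite -[LHS]addr0; apply: HF; last exact: qv.
  have := quadZ 1 r v; rewrite /quad !mul1r => ->.
  by rewrite vv mulr1.
by rewrite normr0 mulr_gt0 ?sqrtr_gt0.
Qed.

Lemma gauss_ms_differentiable (k : nat) (disp : measure_display)
    (T : measurableType disp) (P : probability T R) (Z : 'rV[R]_d -> {RV P >-> R}) :
  (k + d)%:R / 2 < alpha ->
  stationary_field_with_cov (fun h => g (euclidean_norm h)) Z ->
  ms_differentiable k./2 Z.
Proof.
move=> /gauss_local_expansion[phi [e [C [x1 [F [[x1_gt0 C0 ke] ch bd phi0 [sF HF]]]]]]].
move=> [lZ [m EZ] cZ].
have w0 : 0 < (a ^+ 2)^-1 by rewrite invr_gt0 exprn_gt0.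
have k2 : (k./2.*2 <= k)%N by rewrite -{2}(odd_double_half k) leq_addl.
have ZF : second_moment (a ^+ 2)^-1 x1 Z (F (m * m)); last first.
  exact: (smooth_ms_differentiable w0 x1_gt0 C0 ke ch bd phi0
    (smooth_weaken k2 (sF (m * m))) lZ ZF).
move=> x y qxy.
have Pfin : P setT \is a fin_num := fin_num_measure P _ measurableT.
have lx := lZ x; have ly := lZ y.
have cE := covarianceE (Lfun_subset12 Pfin lx) (Lfun_subset12 Pfin ly) (Lfun2_mul_Lfun1 lx ly).
rewrite cZ !EZ in cE.
have := expectation_mul lx ly; move: cE => /[swap] E.
rewrite [X in (X - _)%E]E -EFinM -EFinB => -[] gE.
rewrite -(HF (m * m) (euclidean_norm (x - y)))//; first by rewrite gE subrK.
rewrite /euclidean_norm sqr_sqrtr; last by apply: sumr_ge0 => i _; rewrite sqr_ge0.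
by apply: eq_bigr => i _; rewrite expr2.
Qed.

End gauss_covariance.

Unset Implicit Arguments.

Theorem theorem7 (R : realType) (d : nat) (a alpha beta gamma : R) (k : nat)
    (hd : (1 <= d)%N) (ha : 0 < a) (hP : in_Pd d alpha beta gamma)
    (hk : (1 <= k)%N) :
  (times_derivable k (gauss_cov d a alpha beta gamma) 0 <->
     (k + d)%:R / 2 < alpha)
  /\
  (times_derivable k (gauss_cov d a alpha beta gamma) 0 ->
     forall (disp : measure_display) (T : measurableType disp)
       (P : probability T R) (Z : 'rV[R]_d -> {RV P >-> R}),
       stationary_field_with_cov
         (fun h => gauss_cov d a alpha beta gamma (euclidean_norm h)) Z ->
       ms_differentiable k./2 Z).
Proof.
have only_if : times_derivable k (gauss_cov d a alpha beta gamma) 0 ->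
    (k + d)%:R / 2 < alpha.
  by case: k hk => // k _; exact: gauss_times_derivable_lt.
split; first by split => //; exact: gauss_times_derivable.
by move=> /only_if kal disp T P Z; exact: gauss_ms_differentiable.
Qed.
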